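(* Let $u(x)$ be a finite-gap potential corresponding to an arbitrary curve $\mu^2=(\lambda-E_1)\cdots(\lambda-E_{2g+1})$. Then solutions of the equation $\Psi_{xx}-u(x)\Psi=\lambda\Psi$ are given by the quadratures $$\Psi^{\pm}(x;\lambda)=\exp\frac12\left\{\int^{\gamma_1(x)}\frac{w\pm\mu}{z-\lambda}\,\frac{dz}{w}+\cdots+\int^{\gamma_g(x)}\frac{w\pm\mu}{z-\lambda}\,\frac{dz}{w}\right\},$$ where $w^2=(z-E_1)\cdots(z-E_{2g+1})$ and the functions $\gamma_k=\gamma_k(x)$ are determined by inversion of the set of indefinite integrals $$\sum_{k=1}^{g}\int^{\gamma_k}z^{g-1}\frac{dz}{w}=2x+a_g,\qquad \sum_{k=1}^{g}\int^{\gamma_k}z^{n}\frac{dz}{w}=a_{n+1},\quad n=0,1,\ldots,g-2,$$ with $a_1,\dots,a_g$ constants. The finite-gap potential is determined by the formula $$u(x)=2\sum_{k=1}^{g}\gamma_k(x)-\sum_{k=1}^{2g+1}E_k.$$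
   Context: All functions are complex analytic (meromorphic) in the complex variable $x$; $\lambda$ is a complex parameter and $\mu=\mu(\lambda)$ denotes a fixed square root. Finite-gap potential: $u(x)$ is finite-gap if the equation $R_{xxx}-4(u+\lambda)R_x-2u_xR=0$ has a nonzero solution $R=R(x;\lambda)$ that is a polynomial in $\lambda$, normalized to be monic of degree $g$. The first integral $-\tfrac12RR_{xx}+\tfrac14R_x^2+(u+\lambda)R^2$ is independent of $x$ and equals a polynomial $\mu^2=(\lambda-E_1)\cdots(\lambda-E_{2g+1})$; this is the curve corresponding to $u$. The functions $\gamma_k(x)$ are the roots of $R$: $R(x;\lambda)=(\lambda-\gamma_1(x))\cdots(\lambda-\gamma_g(x))$. All integrals are indefinite integrals (arbitrary constant lower limits) on the curve $w^2=(z-E_1)\cdots(z-E_{2g+1})$; the upper limit $\gamma_k(x)$ stands for the point $(z,w)=(\gamma_k(x),\varrho_k(x))$ of the curve, where $\varrho_k$ is the same branch of the square root in all formulae. *)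

(* Defs.v *)
From HB Require Import structures.
From mathcomp Require Import all_boot all_order all_algebra.
From mathcomp Require Import complex.
From mathcomp Require Import all_classical all_reals all_analysis.
Set Implicit Arguments.
Unset Strict Implicit.
Unset Printing Implicit Defensive.
Import Order.TTheory GRing.Theory Num.Theory.
Import numFieldNormedType.Exports.
Local Open Scope ring_scope.
Local Open Scope complex_scope.
Local Open Scope classical_set_scope.

(* R[i] packed as a numClosedFieldType: this is what gives it the topology and
   the (complex) derivatives of MathComp-Analysis. *)
Definition Cx (R : realType) : numClosedFieldType := R[i].

Section FiniteGap.
Variable R : realType.
Local Notation C := (Cx R).

Definition cexp (z : C) : C :=
  (expR (complex.Re z) * cos (complex.Im z))
    +i* (expR (complex.Re z) * sin (complex.Im z)).

Definition domain (D : set C) : Prop := open D /\ connected D.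

(* Complex derivatives of every order; on an open set this is the same as being
   holomorphic (once complex differentiable), by Goursat's theorem. *)
Definition analytic_on (D : set C) (f : C -> C) : Prop :=
  forall (n : nat) (x : C), D x -> derivable (derive1n n f) x 1.

Section Potential.
Variable g : nat.

(* W x is the polynomial R(x; _); all derivatives of W are taken in x at fixed
   lambda. A potential that is meromorphic on a region is analytic on the
   region Om obtained by removing its poles. *)
Definition finite_gap (Om : set C) (u : C -> C) (W : C -> {poly C}) : Prop :=
  [/\ analytic_on Om u,
      forall i : nat, analytic_on Om (fun x => (W x)`_i),
      forall x, Om x -> W x \is monic /\ size (W x) = g.+1
    & forall (l x : C), Om x ->
        let Wl := fun y => (W y).[l] in
        derive1n 3 Wl x - 4%:R * (u x + l) * derive1 Wl x
          - 2%:R * derive1 u x * Wl x = 0].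

Variable E : 'I_(2 * g + 1) -> C.

Definition curve_poly (z : C) : C := \prod_j (z - E j).

Definition corresponding_curve (Om : set C) (u : C -> C) (W : C -> {poly C})
    : Prop :=
  forall (l x : C), Om x ->
    let Wl := fun y => (W y).[l] in
    - 2%:R^-1 * Wl x * derive1n 2 Wl x + 4%:R^-1 * (derive1 Wl x) ^+ 2
      + (u x + l) * (Wl x) ^+ 2 = curve_poly l.

(* I is an indefinite integral of the form f(z, w) dz on the curve
   w^2 = curve_poly z, as a function of its upper limit (ga x, rho x), x in D.
   Where rho x <> 0, z is a local parameter of the curve, so I is locally
   Phi \o ga for an antiderivative Phi of f(z, w(z)), w being the branch of the
   square root that passes through (ga x, rho x). The remaining points, where
   the upper limit is a branch point, have to be isolated in D; the integral is
   continued through them by continuity. *)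
Definition indef_integral (D : set C) (f : C -> C -> C) (ga rho I : C -> C)
    : Prop :=
  [/\ forall x, D x -> {for x, continuous I},
      forall x, D x -> \forall y \near x^', rho y != 0
    & forall x, D x -> rho x != 0 ->
        exists w Phi : C -> C,
          (\forall z \near ga x,
             [/\ {for z, continuous w}, w z ^+ 2 = curve_poly z
               & is_derive z (1 : C) Phi (f z (w z))]) /\
          (\forall y \near x, w (ga y) = rho y /\ I y = Phi (ga y))].

Definition form_abel (n : nat) (z w : C) : C := z ^+ n / w.

(* s = 1 gives the integrand of Psi^+, s = -1 that of Psi^-. *)
Definition form_psi (s l mu z w : C) : C := (w + s * mu) / (z - l) / w.

(* J n k x stands for the integral of z^n dz / w with upper limit
   (ga k x, rho k x), and a n for the constant usually denoted a_(n+1). *)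
Definition abel_system (D : set C) (ga rho : 'I_g -> C -> C)
    (J : 'I_g -> 'I_g -> C -> C) (a : 'I_g -> C) : Prop :=
  (forall n k : 'I_g, indef_integral D (form_abel n) (ga k) (rho k) (J n k)) /\
  (forall (n : 'I_g) x, D x ->
     \sum_k J n k x = (if n.+1 == g then 2%:R * x else 0) + a n).

End Potential.

Definition schrodinger_solution (D : set C) (u : C -> C) (l : C) (Psi : C -> C)
    : Prop :=
  forall x, D x ->
    [/\ derivable Psi x 1, derivable (derive1 Psi) x 1
      & derive1n 2 Psi x - u x * Psi x = l * Psi x].

End FiniteGap.

(* Main.v *)
(* Put rho_k := - W_x(x; ga_k) / 2, which satisfies rho_k^2 = P(ga_k) by the
   first integral at lambda = ga_k, P being the curve polynomial. Differentiating
   W = prod (lambda - ga_k) gives the Dubrovin equations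
   ga_k' * prod_(j != k) (ga_k - ga_j) = 2 rho_k, valid even where roots collide.
   Lagrange interpolation turns them into the derivatives of the Abel sums and of
   the exponent S of Psi, whose derivative is H = (W_x / 2 - s mu) / W; the first
   integral is then the Riccati equation H' + H^2 = u + lambda.
   The branch points on the way are isolated and the integrals are continuous
   there, so a mean value inequality on segments suffices to cross them and no
   Cauchy theory is needed. Conversely the Abel system determines the
   quotients ga_k' / rho_k by a Vandermonde argument, hence yields the Dubrovin
   equations, and (ga, rho) is unique by Gronwall's argument. *)
Require Import Defs.
From HB Require Import structures.
From mathcomp Require Import all_boot all_order all_algebra.
From mathcomp Require Import complex ring lra zify.
From mathcomp Require Import all_classical all_reals all_analysis.
Set Implicit Arguments.
Unset Strict Implicit.
Unset Printing Implicit Defensive.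
Import Order.TTheory GRing.Theory Num.Theory.
Import numFieldNormedType.Exports.
Local Open Scope ring_scope.
Local Open Scope classical_set_scope.

(** * Continuity and derivatives over a numeric field *)

Lemma continuous_distP (K L : numFieldType) (f : K -> L) (x : K) :
  {for x, continuous f} <->
  forall e, 0 < e -> \forall y \near x, `|f x - f y| <= e.
Proof.
by split=> [/(@cvgrPdist_le _ _ _ _ (nbhs_filter x))|H];
  last exact/(@cvgrPdist_le _ _ _ _ (nbhs_filter x)).
Qed.

Lemma continuous_near (K L : numFieldType) (f : K -> L) (x : K) (P : L -> Prop) :
  {for x, continuous f} -> (\forall y \near f x, P y) ->
  \forall z \near x, P (f z).
Proof. by move=> fc /fc. Qed.

Lemma near_ball (K : numFieldType) (p : K) (P : K -> Prop) :
  (\forall y \near p, P y) ->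
  exists2 r, 0 < r & forall y, `|y - p| < r -> P y.
Proof.
move=> /nbhs_ballP[r /= r0 rP]; exists r => // y yp.
by apply: rP; rewrite /ball/= distrC.
Qed.

Lemma ball_near (K : numFieldType) (p r : K) (P : K -> Prop) : 0 < r ->
  (forall y, `|y - p| < r -> P y) -> \forall y \near p, P y.
Proof.
move=> r0 H; apply/nbhs_ballP; exists r => // y; rewrite /ball/= distrC.
exact: H.
Qed.

Section NumFieldDerivatives.
Variable K : numFieldType.
Implicit Types (f g : K -> K) (x d : K).

(** Clearing the denominator of the difference quotient makes the estimate trivial at [y = x], so
    the punctured neighbourhood becomes a full one. In this form derivatives pass easily between
    real and complex variables. *)
Lemma is_derive_epsP f x d : is_derive x 1 f d <->
  forall e, 0 < e ->
    \forall y \near x, `|f y - f x - d * (y - x)| <= e * `|y - x|.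
Proof.
split=> [[df dfE] e e0|H].
  have /cvgrPdist_le : (fun h : K => h^-1 *: ((f \o shift x) (h *: 1) - f x))
      @ 0^' --> d by rewrite -dfE; exact: df.
  move=> /(_ _ e0); rewrite near_withinE => H.
  have {}H : \forall h \near (0:K),
      `|f (h + x) - f x - d * h| <= e * `|h|.
    apply: filterS H => h; have [->|h0] := eqVneq h 0.
      by rewrite add0r subrr mulr0 subr0 normr0 mulr0.
    move=> /(_ isT); rewrite /= /shift -[h *: 1]/(h * 1) mulr1 => Hh.
    rewrite -ler_pdivrMr ?normr_gt0// -normfV -normrM.
    have -> : (f (h + x) - f x - d * h) / h
      = h^-1 *: (f (h + x) - f x) - d.
      by rewrite mulrBl mulfK// mulrC.
    by rewrite distrC.
  have C : (fun y : K => y - x) @ x --> (0 : K).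
    rewrite -(subrr x); apply: (@cvgB _ _ _ _ (nbhs_filter _) id (cst x)).
      by move=> A.
    exact: cvg_cst.
  by apply: (@filterS _ (nbhs x) _ _ _ _ (C _ H)) => y; rewrite /= subrK.
have D : (fun h : K => h^-1 *: ((f \o shift x) (h *: 1) - f x)) @ 0^' --> d.
  apply/cvgrPdist_le => e e0; have {}H := H _ e0.
  rewrite near_withinE.
  have {}H : \forall h \near (0:K),
      `|f (h + x) - f x - d * h| <= e * `|h|.
    have C : (fun h : K => h + x) @ (0 : K) --> x.
      rewrite -[X in _ --> X]add0r.
      apply: (@cvgD _ _ _ _ (nbhs_filter _) id (cst x)); first by move=> A.
      exact: cvg_cst.
    by apply: (@filterS _ (nbhs (0 : K)) _ _ _ _ (C _ H)) => h; rewrite /= addrK.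
  apply: filterS H => h Hh h0.
  rewrite /= /shift -[h *: 1]/(h * 1) mulr1 distrC.
  have <- : (f (h + x) - f x - d * h) / h
      = h^-1 *: (f (h + x) - f x) - d.
      by rewrite mulrBl mulfK// mulrC.
  by rewrite normrM normfV ler_pdivrMr ?normr_gt0.
by split; [apply/cvg_ex; exists d | apply: cvg_lim].
Qed.

Lemma near_dist_le x e : 0 < e -> \forall y \near x, `|x - y| <= e.
Proof.
by move=> e0; apply: filterS (nbhsx_ballx x e e0) => y; rewrite /ball/= => /ltW.
Qed.

Lemma continuous_cst1 (a : K) x : {for x, continuous (fun _ : K => a)}.
Proof. exact: (@cvg_cst _ a _ (nbhs x) (nbhs_filter x)). Qed.

Lemma continuousD1 f g x : {for x, continuous f} -> {for x, continuous g} ->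
  {for x, continuous (fun y => f y + g y)}.
Proof. exact: (@cvgD _ _ _ _ (nbhs_filter x)). Qed.

Lemma continuousM1 f g x : {for x, continuous f} -> {for x, continuous g} ->
  {for x, continuous (fun y => f y * g y)}.
Proof. exact: (@cvgM _ _ _ (nbhs_filter x)). Qed.

Lemma continuousV1 f x : f x != 0 -> {for x, continuous f} ->
  {for x, continuous (fun y => (f y)^-1)}.
Proof. exact: (@cvgV _ _ _ (nbhs_filter x)). Qed.

Lemma continuous_bigprod1 (I : Type) (r : seq I) (P : pred I) (F : I -> K -> K) x :
  (forall i, {for x, continuous (F i)}) ->
  {for x, continuous (fun y => \prod_(i <- r | P i) F i y)}.
Proof.
move=> FC; elim: r => [|i r IH].
  have -> : (fun y => \prod_(i <- [::] | P i) F i y) = cst 1.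
    by apply/funext => y; rewrite big_nil.
  exact: continuous_cst1.
have -> : (fun y => \prod_(j <- i :: r | P j) F j y)
    = (fun y => (if P i then F i y else 1) * \prod_(j <- r | P j) F j y).
  by apply/funext => y; rewrite big_cons; case: ifP => // _; rewrite mul1r.
apply: continuousM1 IH; case: (P i); [exact: FC | exact: continuous_cst1].
Qed.

Lemma continuous_bigsum1 (I : Type) (r : seq I) (F : I -> K -> K) x :
  (forall i, {for x, continuous (F i)}) ->
  {for x, continuous (fun y => \sum_(i <- r) F i y)}.
Proof.
move=> FC; elim: r => [|i r IH].
  have -> : (fun y => \sum_(i <- [::]) F i y) = cst 0.
    by apply/funext => y; rewrite big_nil.
  exact: continuous_cst1.
have -> : (fun y => \sum_(j <- i :: r) F j y)
    = (fun y => F i y + \sum_(j <- r) F j y).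
  by apply/funext => y; rewrite big_cons.
exact: continuousD1.
Qed.

Lemma continuous_neq0 f x : {for x, continuous f} -> f x != 0 ->
  \forall y \near x, f y != 0.
Proof.
move=> fc fx; have e0 : 0 < `|f x| / 2 by rewrite divr_gt0 ?normr_gt0.
have [+ _] := continuous_distP f x; move=> /(_ fc _ e0); apply: filterS => y.
apply: contraTneq => ->; rewrite subr0 lt_geF// ltr_pdivrMr ?ltr0n//.
by rewrite ltr_pMr ?normr_gt0// ltr1n.
Qed.

Lemma is_derive_continuous f x d : is_derive x 1 f d -> {for x, continuous f}.
Proof. by case=> /derivable1_diffP/differentiable_continuous. Qed.

Lemma derive1_is_derive f x d : is_derive x 1 f d -> f^`() x = d.
Proof. by move=> fd; rewrite derive1E; apply: derive_val. Qed.

Lemma derivable_is_derive1 f x : derivable f x 1 -> is_derive x 1 f (f^`() x).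
Proof. by rewrite derive1E => /derivableP. Qed.

Lemma is_derive_chain f g x d e :
  is_derive (g x) 1 f d -> is_derive x 1 g e -> is_derive x 1 (f \o g) (d * e).
Proof.
move=> [df <-] [dg <-].
have /derivable1_diffP Df := df; have /derivable1_diffP Dg := dg.
split; first exact/derivable1_diffP/differentiable_comp.
rewrite -!derive1E derive1E'; last exact/differentiable_comp.
rewrite diff_comp // !derive1E' //= -[X in 'd  _ _ X = _]mulr1.
by rewrite [LHS]linearZ mulrC.
Qed.

Lemma is_derive_mul f g x d e : is_derive x 1 f d -> is_derive x 1 g e ->
  is_derive x 1 (fun y => f y * g y) (f x * e + g x * d).
Proof. exact: is_deriveM. Qed.

Lemma is_derive_inv f x d : f x != 0 -> is_derive x 1 f d ->
  is_derive x 1 (fun y => (f y)^-1) (- d / f x ^+ 2).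
Proof.
move=> fx0 [df <-]; split; first exact: derivableV.
by rewrite deriveV// /GRing.scale/= mulNr mulrC mulNr.
Qed.

Lemma is_derive_bigsum (I : Type) (r : seq I) (F : I -> K -> K) (dF : I -> K) x :
  (forall i, is_derive x 1 (F i) (dF i)) ->
  is_derive x 1 (fun y => \sum_(i <- r) F i y) (\sum_(i <- r) dF i).
Proof.
move=> FdF; elim: r => [|i r IH].
  rewrite big_nil; have -> : (fun y => \sum_(i <- [::]) F i y) = cst 0.
    by apply/funext => y; rewrite big_nil.
  exact: is_derive_cst.
rewrite big_cons; have -> : (fun y => \sum_(j <- i :: r) F j y)
    = F i + (fun y => \sum_(j <- r) F j y).
  by apply/funext => y; rewrite big_cons.
exact: is_deriveD.
Qed.

(** The Leibniz rule by induction on [r]; [uniq r] ensures that the filter [j != i] drops exactly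
    one factor. *)
Lemma is_derive_bigprod (I : eqType) (r : seq I) (F : I -> K -> K) (dF : I -> K) x :
  uniq r -> (forall i, is_derive x 1 (F i) (dF i)) ->
  is_derive x 1 (fun y => \prod_(i <- r) F i y)
    (\sum_(i <- r) dF i * \prod_(j <- r | j != i) F j x).
Proof.
move=> + FdF; elim: r => [_|i r IH /= /andP[ir ur]].
  rewrite big_nil; have -> : (fun y => \prod_(i <- [::]) F i y) = cst 1.
    by apply/funext => y; rewrite big_nil.
  exact: is_derive_cst.
rewrite big_cons; have -> : (fun y => \prod_(j <- i :: r) F j y)
    = (fun y => F i y * \prod_(j <- r) F j y).
  by apply/funext => y; rewrite big_cons.
have -> : dF i * \prod_(j <- i :: r | j != i) F j x +
   \sum_(j <- r) dF j * \prod_(j0 <- (i :: r) | j0 != j) F j0 x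
 = F i x * (\sum_(j <- r) dF j * \prod_(j0 <- r | j0 != j) F j0 x)
   + (\prod_(j <- r) F j x) * dF i.
  rewrite addrC; congr (_ + _); last first.
    rewrite mulrC; congr (_ * _).
    rewrite big_cons eqxx/= big_seq_cond [RHS]big_seq_cond; apply: eq_bigl => j.
    by have [jr|//] := boolP (j \in r); rewrite andbT (memPn ir).
  rewrite mulr_sumr big_seq_cond [RHS]big_seq_cond.
  apply: eq_bigr => j; rewrite andbT => jr.
  by rewrite big_cons eq_sym (memPn ir)// mulrCA.
by apply: is_derive_mul => //; apply: IH.
Qed.

Lemma is_derive_lin (a b : K) x : is_derive x 1 (fun y => a * y + b) a.
Proof.
apply/is_derive_epsP => e e0; near=> y.
have -> : a * y + b - (a * x + b) - a * (y - x) = 0.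
  by rewrite mulrBr opprD addrACA subrr addr0 subrr.
by rewrite normr0 mulr_ge0// ltW.
Unshelve. all: by end_near. Qed.

End NumFieldDerivatives.

(** * Mean value inequality, Gronwall's argument and the complex exponential *)

Section ComplexCalculus.
Local Open Scope complex_scope.
Variable R : realType.
Local Notation C := (Cx R).

Lemma normC_real (t : R) : `|t%:C : C| = `|t|%:C.
Proof. by rewrite normc_def /= expr0n /= addr0 sqrtr_sqr. Qed.

Lemma normC_Re (z : C) : `|complex.Re z|%:C <= `|z|.
Proof. exact: normc_ge_Re. Qed.

Lemma normC_Im (z : C) : `|complex.Im z|%:C <= `|z|.
Proof.
rewrite normc_def lecR -sqrtr_sqr ler_sqrt ?lerDr ?sqr_ge0//.
by rewrite addr_ge0 ?sqr_ge0.
Qed.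

Lemma normC_le_ReIm (z : C) :
  `|z| <= (`|complex.Re z| + `|complex.Im z|)%:C.
Proof.
rewrite [X in `|X|]complexE (le_trans (ler_normD _ _))// normrM rmorphD /=.
by rewrite !normC_real normc_def /= expr0n /= expr1n add0r sqrtr1 mul1r.
Qed.

Lemma ltC0_real (e : C) : 0 < e -> exists2 r : R, 0 < r & e = r%:C.
Proof. by case: e => a b; rewrite ltcE /= => /andP[/eqP -> a0]; exists a. Qed.

Lemma continuous_complex_Re : continuous (@complex.Re R : C -> R).
Proof.
move=> z; apply/continuous_distP => e e0; near=> w.
rewrite -lecR -raddfB (le_trans (normC_Re _))//.
by near: w; apply: near_dist_le; rewrite ltcR.
Unshelve. all: by end_near. Qed.

Lemma continuous_real_complex : continuous (fun t : R => t%:C : C).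
Proof.
move=> t; apply/continuous_distP => _ /ltC0_real[e e0 ->]; near=> s.
rewrite -rmorphB /= normC_real lecR.
by near: s; apply: near_dist_le.
Unshelve. all: by end_near. Qed.

Lemma continuous_real_line (p v : C) : continuous (fun t : R => p + t%:C * v).
Proof.
move=> t; apply: (@cvgD _ _ _ _ (nbhs_filter t)); first exact: cvg_cst.
apply: (@cvgM _ _ _ (nbhs_filter t)); last exact: cvg_cst.
exact: continuous_real_complex.
Qed.

Lemma is_derive_Re_line (F : C -> C) (p v d : C) (t : R) :
  is_derive (p + t%:C * v) 1 F d ->
  is_derive t 1 (fun s : R => complex.Re (F (p + s%:C * v)))
    (complex.Re (d * v)).
Proof.
move=> /is_derive_epsP H; apply/is_derive_epsP => e e0.
(* [|v| + 1] serves as a denominator that stays positive when [v = 0]. *)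
have v1 : 0 < `|v| + 1 by rewrite ltr_wpDl.
have /H{}H : 0 < e%:C / (`|v| + 1) by rewrite divr_gt0 // ltcR.
have := @continuous_near _ _ _ t _ (@continuous_real_line p v t) H.
apply: filterS => s /= Hs.
rewrite -lecR rmorphM /= -(normC_real (s - t)).
set c := p + t%:C * v in Hs *; set c' := p + s%:C * v in Hs *.
have cc : c' - c = (s - t)%:C * v.
  by rewrite /c /c' opprD addrACA subrr add0r -mulrBl -rmorphB.
have -> : complex.Re (F c') - complex.Re (F c) - complex.Re (d * v) * (s - t)
  = complex.Re (F c' - F c - d * (c' - c)).
  rewrite !raddfB /= cc mulrCA.
  congr (_ - _).
  by case: (d * v) => a b /=; rewrite mul0r subr0 mulrC.
apply: le_trans (normC_Re _) _; apply: le_trans Hs _.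
rewrite cc normrM -mulrA ler_wpM2l//; first by rewrite lecR ltW.
rewrite mulrCA ler_piMr// mulrC ler_pdivrMr// mul1r lerDl.
exact: ler01.
Qed.

(** The mean value theorem has no complex-valued form, so the real one is applied to the real part
    along the segment from [p] to [p + v]. *)
Lemma Re_mean_value (F : C -> C) (p v M : C) :
  (forall t : R, 0 <= t <= 1 -> {for p + t%:C * v, continuous F}) ->
  (forall t : R, 0 < t < 1 -> exists2 d,
     is_derive (p + t%:C * v) 1 F d & `|d| <= M) ->
  `|complex.Re (F (p + v)) - complex.Re (F p)|%:C <= M * `|v|.
Proof.
move=> Fc Fd.
(* The real mean value theorem takes a total derivative function: one is chosen pointwise, with
   default value 0 outside the open interval. *)
have /(_ _)/cid2 D : forall t : R, exists2 d, 0 < t < 1 ->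
   is_derive (p + t%:C * v) 1 F d & (0 < t < 1 -> `|d| <= M).
  move=> t; have [/Fd[d ? ?]|_] := boolP (0 < t < 1); first by exists d.
  by exists 0.
pose df t := let: exist2 d _ _ := D t in d.
have dfP t : 0 < t < 1 -> is_derive (p + t%:C * v) 1 F (df t).
  by rewrite /df; case: (D t).
have dfM t : 0 < t < 1 -> `|df t| <= M.
  by rewrite /df; case: (D t).
have [t| |c] := @MVT R (fun s : R => complex.Re (F (p + s%:C * v)))
    (fun t => complex.Re (df t * v)) 0 1 ltr01.
- by rewrite in_itv /= => /dfP; apply: is_derive_Re_line.
- apply: continuous_in_subspaceT => t; rewrite inE /= in_itv /= => t01 {dfP dfM df D}.
  apply: (continuous_comp (f := fun s : R => p + s%:C * v)
     (g := fun z => complex.Re (F z))).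
    exact: continuous_real_line.
  apply: (continuous_comp (g := @complex.Re R : C -> R)); first exact: Fc.
  exact: continuous_complex_Re.
rewrite in_itv /= => c01; rewrite mul1r mul0r addr0 subr0 mulr1 => ->.
rewrite (le_trans (normC_Re _))// normrM ler_wpM2r// dfM//.
Qed.

(** The imaginary part of [F] is the real part of [- 'i * F]; adding the two bounds costs the factor
    2. *)
Lemma complex_mean_value (F : C -> C) (p v M : C) :
  (forall t : R, 0 <= t <= 1 -> {for p + t%:C * v, continuous F}) ->
  (forall t : R, 0 < t < 1 -> exists2 d,
     is_derive (p + t%:C * v) 1 F d & `|d| <= M) ->
  `|F (p + v) - F p| <= 2%:R * M * `|v|.
Proof.
move=> Fc Fd; have H1 := Re_mean_value Fc Fd.
have H2 : `|complex.Im (F (p + v)) - complex.Im (F p)|%:C <= M * `|v|.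
  have := @Re_mean_value (fun z => - 'i * F z) p v M.
  have E z : complex.Re (- 'i * z) = complex.Im z :> R.
    by case: z => a b /=; rewrite oppr0 mul0r mulN1r add0r opprK.
  rewrite !E; apply.
    by move=> t t01; apply: continuousM1; [exact: continuous_cst1 | exact: Fc].
  move=> t t01; have [d dd dM] := Fd t t01.
  exists (- 'i * d).
    have := is_derive_mul (is_derive_cst (- 'i : C) (p + t%:C * v) 1) dd.
    by rewrite mulr0 addr0.
  by rewrite normrM normrN normc_def /= expr0n /= expr1n add0r sqrtr1 mul1r.
apply: le_trans (normC_le_ReIm _) _.
rewrite !raddfB rmorphD /= -mulrA mulr_natl mulr2n lerD//.
Qed.

(** The open segment from [p] to [q] stays in the punctured ball, where the derivative is bounded;
    this lets the centre be an exceptional point, such as a branch point. *)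
Lemma mean_value_ball (F : C -> C) (p r M : C) :
  (forall y, `|y - p| < r -> {for y, continuous F}) ->
  (forall y, `|y - p| < r -> y != p ->
    exists2 d : C, is_derive (y : C) (1 : C) F d & `|d| <= M) ->
  forall q, `|q - p| < r -> `|F q - F p| <= 2%:R * M * `|q - p|.
Proof.
move=> Fc Fd q qp; have [->|q_neq] := eqVneq q p.
  by rewrite !subrr normr0 mulr0.
have seg (t : R) : 0 <= t <= 1 -> `|p + t%:C * (q - p) - p| < r.
  move=> /andP[t0 t1]; rewrite addrAC subrr add0r normrM normC_real (ger0_norm t0).
  by apply: le_lt_trans qp; rewrite ler_piMl// lecR.
have E : p + (q - p) = q by rewrite addrC subrK.
rewrite -{1}E; apply: complex_mean_value.
  by move=> t /seg; exact: Fc.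
move=> t /andP[t0 t1]; apply: Fd; first by apply: seg; rewrite !ltW.
rewrite -subr_eq0 addrAC subrr add0r mulf_neq0 ?subr_eq0//.
by rewrite eq_complex /= eqxx andbT gt_eqF.
Qed.

Lemma mean_value_near (F : C -> C) (p M : C) :
  (\forall y \near p, {for y, continuous F}) ->
  (\forall y \near p^', exists2 d : C, is_derive (y : C) (1 : C) F d & `|d| <= M) ->
  \forall q \near p, `|F q - F p| <= 2%:R * M * `|q - p|.
Proof.
rewrite near_withinE => Fc Fd.
have [r r0 H] := near_ball (filterI Fc Fd).
by apply: (ball_near r0); apply: mean_value_ball => y /H[].
Qed.

(** With bound 0 the mean value inequality makes [F] locally constant. The level set [B] and its
    complement [B'] in [D] are then both open, and connectedness gives [B = D]. *)
Lemma constant_on_domain (D : set C) (F : C -> C) : domain D ->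
  (forall x, D x -> {for x, continuous F}) ->
  (forall x, D x -> \forall y \near x^', is_derive (y : C) (1 : C) F 0) ->
  forall x y, D x -> D y -> F x = F y.
Proof.
move=> [openD connD] Fc Fd x y Dx Dy.
have loc p : D p -> \forall q \near p, F q = F p.
  move=> Dp; have : \forall q \near p, `|F q - F p| <= 2%:R * 0 * `|q - p|.
    apply: mean_value_near.
      by apply: filterS (open_nbhs_nbhs (conj openD Dp)); exact: Fc.
    by apply: filterS (Fd _ Dp) => q dq; exists 0; rewrite ?normr0.
  apply: filterS => q; rewrite mulr0 mul0r normr_le0 subr_eq0 => /eqP//.
have nbD p : D p -> \forall q \near p, D q.
  by move=> Dp; apply: open_nbhs_nbhs.
pose B := [set z | D z /\ F z = F x].
pose B' := [set z | D z /\ F z != F x].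
have openB : open B.
  rewrite openE => z [Dz Fz]; rewrite /interior.
  by near=> w; split; [near: w; exact: nbD | rewrite -Fz; near: w; exact: loc].
have openB' : open B'.
  rewrite openE => z [Dz Fz]; rewrite /interior.
  near=> w; split; [by near: w; exact: nbD|].
  by have -> : F w = F z by near: w; exact: loc.
have BD : B = D.
  apply: connD; first by exists x.
    by exists B => //; apply/seteqP; split=> [z []|z []].
  exists (~` B'); first exact: open_closedC.
  apply/seteqP; split=> [z [Dz Fz]|z [Dz Bz]]; split => //.
    by case=> _; rewrite Fz eqxx.
  by apply: contrapT => /eqP Fz; apply: Bz.
by have : D y by []; rewrite -{1}BD => -[].
Unshelve. all: by end_near. Qed.

(* A continuous function whose derivative off [p] extends continuously to [p]
   is differentiable at [p]: apply the mean value inequality to [S y - H p * y]. *)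
Lemma is_derive_extend (S H : C -> C) (p : C) :
  (\forall y \near p, {for y, continuous S}) ->
  (\forall y \near p^', is_derive (y : C) (1 : C) S (H y)) ->
  {for p, continuous H} -> is_derive p 1 S (H p).
Proof.
move=> Sc Sd Hc; apply/is_derive_epsP => e e0.
pose F y := S y + (- H p * y + 0).
have : \forall q \near p, `|F q - F p| <= 2%:R * (e / 2%:R) * `|q - p|.
  apply: mean_value_near.
    apply: filterS Sc => y Sy.
    have Ly := is_derive_continuous (is_derive_lin (- H p) 0 y).
    exact: (continuousD1 Sy Ly).
  have e2 : 0 < e / 2%:R by rewrite divr_gt0.
  have [/(_ Hc _ e2) + _] := continuous_distP H p.
  move=> /(@nbhs_dnbhs _ _ _).
  apply: filterS2 Sd => y Sy Hy; exists (H y - H p); last by rewrite distrC.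
  exact: is_deriveD Sy (is_derive_lin (- H p) 0 y).
apply: filterS => q; rewrite mulrCA divff ?mulr1 ?pnatr_eq0//.
have -> // : F q - F p = S q - S p - H p * (q - p).
rewrite /F !addr0 opprD addrACA; congr (_ + _).
by rewrite !mulNr opprK mulrBr opprB addrC.
Qed.

(* Gronwall's argument: by the mean value inequality, a bound [2 ^- n] on all the
   [z i] over a fixed small ball improves to [2 ^- n.+1]. *)
Lemma gronwall_zero (I : finType) (z : I -> C -> C) (x0 L : C) : 0 <= L ->
  (forall i, z i x0 = 0) ->
  (\forall y \near x0, forall i, exists2 d : C, is_derive (y : C) (1 : C) (z i) d &
     `|d| <= L * \sum_j `|z j y|) ->
  \forall y \near x0, forall i, z i y = 0.
Proof.
move=> L0 z0 zd.
have zc i : {for x0, continuous (z i)}.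
  by have [d dd _] := nbhs_singleton zd i; apply: is_derive_continuous dd.
have z1 : \forall y \near x0, forall i, `|z i y| <= 1.
  apply: (@filter_forall _ _ (fun i y => `|z i y| <= 1) _ (nbhs_filter x0)) => i.
  have [/(_ (zc i) _ ltr01) + _] := continuous_distP (z i) x0.
  by apply: filterS => y; rewrite z0 add0r normrN.
have [r r0 rP] := near_ball (filterI zd z1).
pose N : C := #|I|%:R.
have N0 : 0 <= N by rewrite ler0n.
(* The 4 is the factor 2 of the mean value inequality times the 2 gained at each halving. The radius
   [r'] below is built to satisfy both [r' <= r] and [A * r' <= 1]. *)
pose A := L * N * 4%:R; have A0 : 0 <= A by rewrite !mulr_ge0 ?ler0n.
have rA : 0 < 1 + r * A by rewrite ltr_pwDl// mulr_ge0// ltW.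
pose r' := r / (1 + r * A).
have r'0 : 0 < r' by rewrite divr_gt0.
have r'r : r' <= r.
  rewrite ler_pdivrMr// ler_peMr//; first exact: ltW.
  by rewrite lerDl mulr_ge0// ltW.
have r'A : A * r' <= 1.
  by rewrite mulrC mulrAC ler_pdivrMr// mul1r lerDr ler01.
have bound n y : `|y - x0| < r' -> forall i, `|z i y| <= 2%:R ^- n.
  elim: n y => [|n IH] y yr i.
    by rewrite expr0 invr1; have [_] := rP y (lt_le_trans yr r'r); apply.
  have sub w : `|w - x0| < r' -> `|w - x0| < r by move=> /lt_le_trans; apply.
  have := @mean_value_ball (z i) x0 r' (L * (N * 2%:R ^- n)) _ _ y yr.
  rewrite z0 subr0 => H; apply: le_trans (H _ _) _.
  - move=> w /sub/rP[+ _] => /(_ i)[d dd _]; exact: is_derive_continuous dd.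
  - move=> w wr _; have [/(_ i)[d dd dL] _] := rP w (sub _ wr).
    exists d => //; apply: le_trans dL _; rewrite ler_wpM2l//.
    apply: le_trans (ler_sum _ (fun j _ => IH w wr j)) _.
    by rewrite sumr_const /N [in X in _ <= X]mulr_natl.
  have -> : 2%:R * (L * (N * 2%:R ^- n)) * `|y - x0| =
      A * `|y - x0| * 2%:R ^- n.+1.
    rewrite exprS invfM /A; set h := 2%:R ^- n.
    have -> : L * N * 4%:R * `|y - x0| * (2%:R^-1 * h)
      = (4%:R / 2%:R) * (L * (N * h)) * `|y - x0| by ring.
    congr (_ * _ * _).
    by rewrite -[4%N]/(2 * 2)%N natrM mulfK// pnatr_eq0.
  rewrite ler_piMl ?invr_ge0 ?exprn_ge0//.
  by apply: le_trans r'A; rewrite ler_wpM2l// ltW.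
apply: (ball_near r'0) => y yr i; apply/eqP; rewrite -normr_le0.
apply: contrapT => /negP; rewrite normr_le0 -normr_gt0 => /ltC0_real[a a0 zE].
(* A positive norm [a] would exceed [2 ^- n] as soon as [n] bounds [a^-1]. *)
have := bound (Num.bound a^-1) y yr i.
have -> : 2%:R ^- Num.bound a^-1 = (2%:R ^- Num.bound a^-1)%:C :> C.
  by rewrite fmorphV rmorphXn /= rmorph_nat.
rewrite zE lecR leNgt => /negP; apply.
rewrite invf_plt ?posrE ?exprn_gt0//.
have /archi_boundP/lt_le_trans : 0 <= a^-1 by rewrite invr_ge0 ltW.
by apply; rewrite -natrX ler_nat ltnW// ltn_expl.
Qed.

(** * The complex exponential and its derivative *)

Lemma cexpD (z w : C) : cexp (z + w) = cexp z * cexp w.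
Proof.
case: z w => a b [c d]; apply/eqP; rewrite eq_complex /cexp /= expRD cosD sinD.
apply/andP; split; apply/eqP; ring.
Qed.

(** The remainder [cexp h - 1 - h] is split so that each piece is controlled by a first-order
    expansion of [expR], [cos] or [sin] at 0, or by the continuity of [expR]. *)
Lemma is_derive_cexp0 : is_derive (0 : C) 1 (@cexp R) 1.
Proof.
apply/is_derive_epsP => _ /ltC0_real[e0 e00 ->].
(* The pieces below add up to [e * |a| + 5 * e * |b|], at most [6 * e] times the larger of [|a|] and
   [|b|]. *)
pose e := e0 / 6%:R; have ep : 0 < e by rewrite divr_gt0.
have zr (P : R -> Prop) : (\forall a \near (0 : R), P a) ->
    (\forall h \near (0 : C), P (complex.Re h)) /\
    (\forall h \near (0 : C), P (complex.Im h)).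
  move=> [r /= r0 rP].
  have r0' : 0 < r%:C :> C by rewrite ltcR.
  split; apply: (ball_near r0') => h; rewrite subr0 => hr; apply: rP;
    rewrite /= sub0r normrN -ltcR; apply: le_lt_trans hr.
    exact: normC_Re.
  exact: normC_Im.
have [/(_ (is_derive_expR 0) _ ep)/zr[E1 _] _] := is_derive_epsP (@expR R) 0 (expR 0).
have [/(_ (is_derive_cos 0) _ ep)/zr[_ E2] _] := is_derive_epsP (@cos R) 0 (- sin 0).
have [/(_ (is_derive_sin 0) _ ep)/zr[_ E3] _] := is_derive_epsP (@sin R) 0 (cos 0).
(* Closeness within [e] bounds the mixed term [(expR a - 1) * b]; closeness within 1 gives
   [expR a <= 2]. *)
have e1 : 0 < Num.min e 1 by rewrite lt_min ep ltr01.
have [/(_ (@continuous_expR R 0) _ e1)/zr[E4 _] _] := continuous_distP (@expR R) 0.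
apply: filterS3 (filterI E1 E2) E3 E4 => -[a b] /= [].
rewrite !subr0 expR0 cos0 sin0 oppr0 mul0r !mul1r !subr0 le_min addr0.
move=> A1 A2 A3 /andP[].
rewrite ![`|1 - _|]distrC => A4 A5.
have -> : cexp ((a +i* b) : C) - cexp 0 - (a +i* b) =
   (expR a * (cos b - 1) + (expR a - 1 - a)) +i*
   (expR a * (sin b - b) + (expR a - 1) * b).
  apply/eqP; rewrite eq_complex /cexp /= expR0 cos0 sin0 mul1r mulr0.
  by apply/andP; split; apply/eqP; ring.
apply: le_trans (normC_le_ReIm _) _ => /=.
have F : e0%:C * `|a +i* b : C| = (6%:R * e)%:C * `|a +i* b : C|.
  by congr (_%:C * _); rewrite /e mulrCA divff ?mulr1// pnatr_eq0.
rewrite F.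
have F2 : ((6%:R * e) * ((`|a| + 5%:R * `|b|) / 6%:R))%:C
    <= (6%:R * e)%:C * `|a +i* b : C|.
  rewrite [X in X <= _]rmorphM /= ler_wpM2l//; first by rewrite lecR mulr_ge0// ltW.
  have : (`|a| + 5%:R * `|b|) / 6%:R <= Num.max `|a| `|b|.
    rewrite ler_pdivrMr//; case: (leP `|a| `|b|) => ab; lra.
  rewrite -lecR => /le_trans; apply; rewrite maxEle; case: ifP => _.
    exact: normC_Im (a +i* b).
  exact: normC_Re (a +i* b).
apply: le_trans F2; rewrite lecR.
have expa : `|expR a| <= 2%:R.
  have -> : expR a = (expR a - 1) + 1 by rewrite subrK.
  by apply: le_trans (ler_normD _ _) _; rewrite normr1; lra.
have G1 : `|expR a * (cos b - 1)| <= 2%:R * (e * `|b|) by rewrite normrM ler_pM.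
have G2 : `|expR a * (sin b - b)| <= 2%:R * (e * `|b|) by rewrite normrM ler_pM.
have G3 : `|(expR a - 1) * b| <= e * `|b| by rewrite normrM ler_pM.
have := ler_normD (expR a * (cos b - 1)) (expR a - 1 - a).
have := ler_normD (expR a * (sin b - b)) ((expR a - 1) * b).
have -> : 6%:R * e * ((`|a| + 5%:R * `|b|) / 6%:R) = e * `|a| + 5%:R * (e * `|b|).
  by field.
lra.
Qed.

(** The addition formula moves the base point to 0: [cexp y = cexp z * cexp (y - z)]. *)
Lemma is_derive_cexp (z : C) : is_derive z 1 (@cexp R) (cexp z).
Proof.
have fE : @cexp R = (fun y => cst (cexp z) y * (@cexp R \o (fun y => 1 * y + (- z))) y).
  by apply/funext => y /=; rewrite -cexpD mul1r addrC subrK.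
have E : is_derive (1 * z + - z) 1 (@cexp R) 1.
  by rewrite mul1r subrr; exact: is_derive_cexp0.
rewrite [X in is_derive _ _ X _]fE.
have := is_derive_mul (is_derive_cst (cexp z) z 1)
  (@is_derive_chain _ _ (fun y : C => 1 * y + (- z)) z _ _ E (is_derive_lin 1 (- z) z)).
by rewrite /= mulr0 addr0 !mulr1.
Qed.

End ComplexCalculus.

(** * Analytic functions *)

Section AnalyticOn.
Variables (R : realType) (D : set (Cx R)) (openD : open D).
Local Notation C := (Cx R).
Implicit Types f g : C -> C.

Lemma open_near (x : C) (P : C -> Prop) :
  D x -> (forall y, D y -> P y) -> \forall y \near x, P y.
Proof. by move=> Dx H; apply: filterS (open_nbhs_nbhs (conj openD Dx)). Qed.

(** A coinduction principle: in a class closed under differentiation on [D], the derivative can be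
    iterated forever. The derivative has to match a member of the class on [D] only. *)
Lemma analytic_on_coind (P : (C -> C) -> Prop) :
  (forall f, P f ->
     exists2 h, P h & forall x, D x -> is_derive x (1 : C) f (h x)) ->
  forall f, P f -> analytic_on D f.
Proof.
move=> PD f Pf n.
have [h Ph fh] : exists2 h, P h & forall x, D x -> derive1n n f x = h x.
  elim: n => [|n [h Ph fh]]; first by exists f.
  have [h' Ph' hh'] := PD _ Ph; exists h' => // x Dx; rewrite derive1nS.
  apply: derive1_is_derive; apply: near_eq_is_derive (hh' _ Dx).
  by apply: open_near => // y Dy; rewrite fh.
move=> x Dx; have [h' _ /(_ _ Dx)[dh _]] := PD _ Ph.
by apply: near_eq_derivable dh; apply: open_near => // y Dy; rewrite fh.
Qed.

Lemma analytic_on_is_derive f x :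
  analytic_on D f -> D x -> is_derive x (1 : C) f (f^`() x).
Proof. by move=> fa Dx; apply: derivable_is_derive1; exact: (fa 0). Qed.

Lemma analytic_on_derive f : analytic_on D f -> analytic_on D f^`().
Proof. by move=> fa n x Dx; rewrite -derive1Sn; exact: fa. Qed.

Lemma eq_analytic_on f g :
  (forall x, D x -> f x = g x) -> analytic_on D f -> analytic_on D g.
Proof.
move=> fg fa.
apply: (@analytic_on_coind (fun h => exists2 k, analytic_on D k &
   forall x, D x -> k x = h x)) => [h [k ka kh]|]; last by exists f.
exists k^`(); first by exists k^`(); [exact: analytic_on_derive | move].
move=> x Dx; apply: near_eq_is_derive (analytic_on_is_derive ka Dx).
exact: open_near.
Qed.

Lemma analytic_on_cst (a : C) : analytic_on D (cst a).
Proof.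
apply: (@analytic_on_coind (fun h => exists b, h = cst b)); last by exists a.
move=> _ [b ->]; exists (cst 0); first by exists 0.
by move=> x _; exact: is_derive_cst.
Qed.

(** Products alone are not closed under differentiation, but sums of products are, by the Leibniz
    rule; this is the class fed to [analytic_on_coind]. *)
Inductive analytic_span : (C -> C) -> Prop :=
| analytic_span_base f : analytic_on D f -> analytic_span f
| analytic_span_add f g : analytic_span f -> analytic_span g ->
    analytic_span (fun x => f x + g x)
| analytic_span_mul f g : analytic_span f -> analytic_span g ->
    analytic_span (fun x => f x * g x).

Lemma analytic_span_on f : analytic_span f -> analytic_on D f.
Proof.
apply: analytic_on_coind => {}f; elim=> [{}f fa|{}f g fs [f' f's fd] gs [g' g's gd]
  |{}f g fs [f' f's fd] gs [g' g's gd]].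
- exists f^`(); first exact/analytic_span_base/analytic_on_derive.
  by move=> x; exact: analytic_on_is_derive.
- exists (fun x => f' x + g' x); first exact: analytic_span_add.
  by move=> x Dx; apply: is_deriveD (fd x Dx) (gd x Dx).
- exists (fun x => f x * g' x + g x * f' x).
    by apply: analytic_span_add; apply: analytic_span_mul.
  by move=> x Dx; apply: is_derive_mul (fd x Dx) (gd x Dx).
Qed.

Lemma analytic_onD f g : analytic_on D f -> analytic_on D g ->
  analytic_on D (fun x => f x + g x).
Proof.
by move=> fa ga; apply/analytic_span_on/analytic_span_add;
  apply: analytic_span_base.
Qed.

Lemma analytic_onM f g : analytic_on D f -> analytic_on D g ->
  analytic_on D (fun x => f x * g x).
Proof.
by move=> fa ga; apply/analytic_span_on/analytic_span_mul;
  apply: analytic_span_base.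
Qed.

Lemma analytic_onX f n : analytic_on D f -> analytic_on D (fun x => f x ^+ n).
Proof.
move=> fa; elim: n => [|n IH]; first exact: analytic_on_cst.
by apply: eq_analytic_on (analytic_onM fa IH) => x _; rewrite exprS.
Qed.

Lemma analytic_on_sum (I : Type) (r : seq I) (F : I -> C -> C) :
  (forall i, analytic_on D (F i)) -> analytic_on D (fun x => \sum_(i <- r) F i x).
Proof.
move=> Fa; elim: r => [|i r IH].
  have -> : (fun x => \sum_(i <- [::]) F i x) = cst 0.
    by apply/funext => x; rewrite big_nil.
  exact: analytic_on_cst.
have -> : (fun x => \sum_(j <- i :: r) F j x)
    = (fun x => F i x + \sum_(j <- r) F j x).
  by apply/funext => x; rewrite big_cons.
exact: (analytic_onD (Fa i) IH).
Qed.

End AnalyticOn.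

(** * Lagrange interpolation and the trace formula *)

Section Interpolation.
Variables (F : fieldType) (g : nat) (x : 'I_g -> F).

(** The Lagrange denominator: the derivative at [x k] of the polynomial with roots [x j]. *)
Definition node_prod (k : 'I_g) : F := \prod_(j | j != k) (x k - x j).

Definition node_poly (k : 'I_g) : {poly F} := \prod_(j | j != k) ('X - (x j)%:P).

Lemma size_node_poly k : size (node_poly k) = g.
Proof.
rewrite /node_poly -big_filter; have [e _ _ [_ se]] := big_enumP.
by rewrite size_prod_XsubC se cardC1 card_ord prednK// (leq_trans _ (ltn_ord k)).
Qed.

Lemma node_poly_lead k : (node_poly k)`_g.-1 = 1.
Proof.
rewrite -[X in X.-1](size_node_poly k) -lead_coefE; apply/monicP.
exact: monic_prod_XsubC.
Qed.

Lemma horner_node_poly k : (node_poly k).[x k] = node_prod k.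
Proof. by rewrite horner_prod; apply: eq_bigr => j _; rewrite hornerXsubC. Qed.

Lemma horner_node_poly_neq k m : m != k -> (node_poly k).[x m] = 0.
Proof.
by move=> mk; rewrite horner_prod (bigD1 m)//= hornerXsubC subrr mul0r.
Qed.

(** Inversion of a Vandermonde system: the moments are combined with the coefficients of
    [node_poly k], which vanishes at the other nodes. As it is monic of degree [g.-1], only the top
    moment [c] survives. *)
Lemma moments_node_prod (y : 'I_g -> F) (c : F) :
  (forall n : 'I_g, \sum_k x k ^+ n * y k = if n.+1 == g then c else 0) ->
  forall k, node_prod k * y k = c.
Proof.
move=> H k.
have : \sum_m (node_poly k).[x m] * y m = c.
  under eq_bigr do rewrite (@horner_coef_wide _ g) ?size_node_poly// mulr_suml.
  rewrite exchange_big /=.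
  under eq_bigr => i _.
    under eq_bigr do rewrite -mulrA.
    rewrite -mulr_sumr H; over.
  have gk : (0 < g)%N := leq_trans (ltn0Sn k) (ltn_ord k).
  have g0 : (g.-1 < g)%N by rewrite prednK.
  rewrite (bigD1 (Ordinal g0))//= prednK ?(leq_trans _ g0)// eqxx node_poly_lead mul1r.
  rewrite big1 ?addr0// => i /eqP iN; case: eqP; rewrite ?mulr0// => ig.
  by case: iN; apply/val_inj; exact: (congr1 predn ig).
rewrite (bigD1 k)//= big1 ?addr0 ?horner_node_poly// => m mk.
by rewrite horner_node_poly_neq// mul0r.
Qed.

Lemma node_prod_inj : (forall k, node_prod k != 0) -> injective x.
Proof.
move=> H i j xij; apply/eqP; apply: contraTT (H i) => ij; rewrite negbK.
by rewrite /node_prod (bigD1 j) 1?eq_sym//= xij subrr mul0r.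
Qed.

Hypothesis nodes_neq : forall k, node_prod k != 0.

(** The difference of the two sides has size at most [g] and vanishes at [g] distinct nodes. *)
Lemma lagrange_poly (p : {poly F}) : (size p <= g)%N ->
  p = \sum_k (p.[x k] / node_prod k) *: node_poly k.
Proof.
move=> sp; apply/eqP; rewrite -subr_eq0; apply/eqP.
set q := \sum_k _.
apply: (@roots_geq_poly_eq0 _ _ [seq x k | k <- enum 'I_g]).
- apply/allP => _ /mapP[k _ ->]; rewrite /root hornerD hornerN horner_sum.
  rewrite (bigD1 k)//= big1 ?addr0.
    by rewrite hornerZ horner_node_poly divfK// subrr.
  by move=> m mk; rewrite hornerZ horner_node_poly_neq ?mulr0// eq_sym.
- by rewrite map_inj_uniq ?enum_uniq//; exact: node_prod_inj.
- rewrite size_map size_enum_ord (leq_trans (size_polyD _ _))// geq_max sp size_polyN.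
  apply: (leq_trans (size_sum _ _ _)); apply/bigmax_leqP => k _.
  by rewrite (leq_trans (size_scale_leq _ _))// size_node_poly.
Qed.

(** Compare the coefficients of degree [g.-1] in the interpolation formula for ['X^n]. *)
Lemma lagrange_moments (n : 'I_g) :
  \sum_k x k ^+ n / node_prod k = if n.+1 == g then 1 else 0.
Proof.
have sn : (size ('X^n : {poly F}) <= g)%N by rewrite size_polyXn.
have g0 : (0 < g)%N := leq_trans (ltn0Sn n) (ltn_ord n).
have := congr1 (fun p : {poly F} => p`_g.-1) (lagrange_poly sn).
rewrite coefXn coef_sum => E; rewrite -(_ : (g.-1 == n)%:R = if _ then _ else _).
  rewrite E; apply: eq_bigr => k _.
  by rewrite coefZ node_poly_lead mulr1 hornerXn.
have -> : (n.+1 == g) = (g.-1 == n :> nat) by lia.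
by case: (g.-1 == n :> nat).
Qed.

(** The interpolation formula for the constant 1, evaluated at [l]: a partial fraction expansion of
    the inverse of the nodal polynomial. *)
Lemma lagrange_resolvent (l : F) : (0 < g)%N -> (forall k, x k != l) ->
  \sum_k ((x k - l) * node_prod k)^-1 = - (\prod_k (l - x k))^-1.
Proof.
move=> g0 xl; have s1 : (size (1%R : {poly F}) <= g)%N by rewrite size_poly1.
have lx k : l - x k != 0 by rewrite subr_eq0 eq_sym.
have P0 : \prod_k (l - x k) != 0 by apply/prodf_neq0 => k _.
have := congr1 (fun p : {poly F} => p.[l]) (lagrange_poly s1).
rewrite hornerC horner_sum => E.
apply: (mulIf P0); rewrite mulNr mulVf// mulr_suml [X in _ = - X]E -sumrN.
apply: eq_bigr => k _; rewrite hornerC hornerZ invfM div1r horner_prod.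
rewrite (bigD1 k)//= -opprB invrN mulNr mulNr; congr (- _).
rewrite mulrAC mulrA mulVf// mul1r mulrC.
by congr (_ * _); apply: eq_bigr => j _; rewrite hornerXsubC.
Qed.

End Interpolation.

(** * Comparison of coefficients and the trace formula *)

Lemma poly_eq_horner (F : numDomainType) (p q : {poly F}) :
  (forall l, p.[l] = q.[l]) -> p = q.
Proof.
move=> pq; apply/eqP; rewrite -subr_eq0; apply/eqP.
apply: (@roots_geq_poly_eq0 _ _ [seq n%:R | n <- iota 0 (size (p - q))]).
- by apply/allP => _ /mapP[n _ ->]; rewrite /root hornerD hornerN pq subrr.
- by rewrite map_inj_uniq ?iota_uniq//; exact: mulrIn (oner_neq0 F).
- by rewrite size_map size_iota.
Qed.

Lemma coef_prod_XsubC_ord (F : idomainType) (n : nat) (x : 'I_n.+1 -> F) :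
  (\prod_k ('X - (x k)%:P))`_n = - \sum_k x k.
Proof.
rewrite -!big_enum -(big_map x predT (fun a => 'X - a%:P)) -(big_map x predT id).
move: (map x _) (size_map x (enum xpredT)) => s; rewrite size_enum_ord => ss.
by have := @coefPn_prod_XsubC _ s; rewrite ss; apply.
Qed.

(** Compare the coefficients of degree [2 * g]. The terms with [W1] and [W2] have smaller degree, so
    only [u] and the second coefficient of [W ^+ 2] remain on the left. *)
Lemma trace_formula (F : fieldType) (g : nat) (x : 'I_g -> F)
    (E : 'I_(2 * g + 1) -> F) (a b u : F) (W W1 W2 : {poly F}) :
  (0 < g)%N -> W = \prod_k ('X - (x k)%:P) ->
  (size W1 <= g)%N -> (size W2 <= g)%N ->
  a *: (W * W2) + b *: W1 ^+ 2 + (u%:P + 'X) * W ^+ 2 = \prod_j ('X - (E j)%:P) ->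
  u = 2%:R * \sum_k x k - \sum_j E j.
Proof.
move=> g0 WE s1 s2.
have sW : size W = g.+1 by rewrite WE -big_enum size_prod_XsubC size_enum_ord.
have Wm : W \is monic by rewrite WE monic_prod_XsubC.
have sWW : size (W ^+ 2) = (2 * g).+1.
  by rewrite expr2 size_monicM ?monic_neq0// sW; lia.
move=> /(congr1 (fun p : {poly F} => p`_(2 * g))).
have -> : (\prod_j ('X - (E j)%:P))`_(2 * g) = - \sum_j E j.
  move: E; rewrite addn1 => E; exact: coef_prod_XsubC_ord.
rewrite !coefD !coefZ mulrDl coefD coefCM coefXM.
have -> : (W * W2)`_(2 * g) = 0.
  by rewrite nth_default// (leq_trans (size_polyMleq _ _))// sW; lia.
have -> : (W1 ^+ 2)`_(2 * g) = 0.
  by rewrite nth_default// expr2 (leq_trans (size_polyMleq _ _))//; lia.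
have -> : (W ^+ 2)`_(2 * g) = 1.
  rewrite -[X in _`_X]/((2 * g).+1.-1) -sWW -lead_coefE; apply/monicP.
  exact: monic_exp.
rewrite ifF; last by lia.
have -> : (W ^+ 2)`_(2 * g).-1 = - (2%:R * \sum_k x k).
  (* Listing every root twice makes Vieta's formula apply to [W ^+ 2]. *)
  pose s := [seq x k | k <- enum 'I_g].
  have ss : size (s ++ s) = (2 * g)%N.
    by rewrite size_cat size_map size_enum_ord mul2n addnn.
  have -> : W ^+ 2 = \prod_(p <- s ++ s) ('X - p%:P).
    by rewrite WE -big_enum big_cat !big_map expr2.
  rewrite -ss coefPn_prod_XsubC ?ss; last by lia.
  by rewrite big_cat !big_map -[\sum_(k < g) x k]big_enum mulr_natl mulr2n.
rewrite !mulr0 mulr1 !add0r => /eqP; rewrite subr_eq => /eqP ->.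
by rewrite addrC.
Qed.

(** * Lipschitz dependence *)

Lemma is_derive_horner (K : numFieldType) (p : {poly K}) (x : K) :
  is_derive x (1 : K) (horner p) p^`().[x].
Proof.
elim/poly_ind: p => [|p c IH].
  rewrite deriv0 horner0 (_ : horner 0 = cst 0); first exact: is_derive_cst.
  by apply/funext => y; rewrite horner0.
rewrite (_ : horner _ = fun y => p.[y] * (1 * y + 0) + c); last first.
  by apply/funext => y; rewrite hornerMXaddC mul1r addr0.
have H := is_deriveD (is_derive_mul IH (is_derive_lin 1 0 x)) (is_derive_cst c x 1).
apply: is_derive_eq H _.
rewrite derivD derivM derivX derivC addr0 mulr1 mul1r addr0 addr0.
by rewrite !hornerE addrC mulrC.
Qed.

Section LipschitzPairs.
Variables (K : numFieldType) (x0 : K) (m : K -> K).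
Hypothesis m_ge0 : forall y, 0 <= m y.
Implicit Types f g : K -> K.

(** [f1] and [f2] stand for one expression evaluated along two solutions, and [m] for the distance
    between these. The bounds on both functions make the notion stable under products. *)
Definition lipschitz_pair f1 f2 := exists2 L, 0 <= L &
  \forall y \near x0, [/\ `|f1 y| <= L, `|f2 y| <= L & `|f1 y - f2 y| <= L * m y].

Lemma continuous_bounded f : {for x0, continuous f} ->
  \forall y \near x0, `|f y| <= `|f x0| + 1.
Proof.
move=> fc; have [/(_ fc _ ltr01) + _] := continuous_distP f x0.
apply: filterS => y fy; rewrite -[f y](subrK (f x0)) addrC.
by rewrite (le_trans (ler_normD _ _))// lerD2l distrC.
Qed.

Lemma lipschitz_pair_base f1 f2 :
  {for x0, continuous f1} -> {for x0, continuous f2} ->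
  (forall y, `|f1 y - f2 y| <= m y) -> lipschitz_pair f1 f2.
Proof.
move=> /continuous_bounded c1 /continuous_bounded c2 f12.
exists (`|f1 x0| + 1 + (`|f2 x0| + 1)); first by rewrite !addr_ge0.
apply: filterS2 c1 c2 => y h1 h2; split.
- by rewrite (le_trans h1)// lerDl addr_ge0.
- by rewrite (le_trans h2)// lerDr addr_ge0.
- by rewrite (le_trans (f12 y))// ler_peMl// addrAC lerDr.
Qed.

Lemma lipschitz_pair_cst a : lipschitz_pair (cst a) (cst a).
Proof.
exists `|a|; first exact: normr_ge0.
by apply: (@filterE _ _ (nbhs_filter x0)) => y; rewrite subrr normr0 mulr_ge0.
Qed.

Lemma lipschitz_pairD f1 f2 g1 g2 : lipschitz_pair f1 f2 -> lipschitz_pair g1 g2 ->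
  lipschitz_pair (fun y => f1 y + g1 y) (fun y => f2 y + g2 y).
Proof.
move=> [L L0 Lf] [M M0 Mg]; exists (L + M); first exact: addr_ge0.
apply: filterS2 Lf Mg => y [h1 h2 h3] [k1 k2 k3]; split.
- by rewrite (le_trans (ler_normD _ _))// lerD.
- by rewrite (le_trans (ler_normD _ _))// lerD.
- by rewrite opprD addrACA (le_trans (ler_normD _ _))// mulrDl lerD.
Qed.

Lemma lipschitz_pairM f1 f2 g1 g2 : lipschitz_pair f1 f2 -> lipschitz_pair g1 g2 ->
  lipschitz_pair (fun y => f1 y * g1 y) (fun y => f2 y * g2 y).
Proof.
move=> [L L0 Lf] [M M0 Mg]; exists (L * M + L * M).
  by rewrite addr_ge0// mulr_ge0.
apply: filterS2 Lf Mg => y [h1 h2 h3] [k1 k2 k3].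
have LM : 0 <= L * M by rewrite mulr_ge0.
split.
- by rewrite normrM ler_wpDr// ler_pM.
- by rewrite normrM ler_wpDr// ler_pM.
- have -> : f1 y * g1 y - f2 y * g2 y = f1 y * (g1 y - g2 y) + (f1 y - f2 y) * g2 y.
    by ring.
  rewrite [X in _ <= X]mulrDl (le_trans (ler_normD _ _))// lerD// normrM.
    by rewrite -mulrA ler_pM.
  by rewrite -mulrA [M * _]mulrC mulrA ler_pM.
Qed.

Lemma lipschitz_pairV f1 f2 : lipschitz_pair f1 f2 ->
  {for x0, continuous f1} -> {for x0, continuous f2} ->
  f1 x0 != 0 -> f2 x0 != 0 ->
  lipschitz_pair (fun y => (f1 y)^-1) (fun y => (f2 y)^-1).
Proof.
move=> [L L0 Lf] c1 c2 n1 n2.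
have N1 := continuous_neq0 c1 n1; have N2 := continuous_neq0 c2 n2.
have := continuous_bounded (continuousV1 n1 c1); set B1 := _ + 1 => b1.
have := continuous_bounded (continuousV1 n2 c2); set B2 := _ + 1 => b2.
have B10 : 0 <= B1 by rewrite addr_ge0.
have B20 : 0 <= B2 by rewrite addr_ge0.
have LB : 0 <= L * B1 * B2 by rewrite !mulr_ge0.
exists (L * B1 * B2 + (B1 + B2)); first by rewrite !addr_ge0.
apply: filterS3 Lf (filterI N1 N2) (filterI b1 b2) => y [_ _ h] [m1 m2] [k1 k2]; split.
- by rewrite (le_trans k1)// ler_wpDl// lerDl.
- by rewrite (le_trans k2)// ler_wpDl// lerDr.
- have -> : (f1 y)^-1 - (f2 y)^-1 = - ((f1 y - f2 y) * (f1 y)^-1 * (f2 y)^-1).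
    by field; rewrite m1 m2.
  rewrite normrN !normrM mulrDl ler_wpDr//; first by rewrite mulr_ge0// addr_ge0.
  have -> : L * B1 * B2 * m y = L * m y * B1 * B2 by ring.
  by rewrite ler_pM ?mulr_ge0// ler_pM.
Qed.

Lemma lipschitz_pair_prod (I : Type) (r : seq I) (P : pred I) (F1 F2 : I -> K -> K) :
  (forall i, lipschitz_pair (F1 i) (F2 i)) ->
  lipschitz_pair (fun y => \prod_(i <- r | P i) F1 i y)
                 (fun y => \prod_(i <- r | P i) F2 i y).
Proof.
move=> H; elim: r => [|i r IH].
  have E (F : I -> K -> K) : (fun y => \prod_(i <- [::] | P i) F i y) = cst 1.
    by apply/funext => y; rewrite big_nil.
  by rewrite !E; exact: lipschitz_pair_cst.
have E (F : I -> K -> K) : (fun y => \prod_(j <- i :: r | P j) F j y)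
    = (fun y => (if P i then F i else cst 1) y * \prod_(j <- r | P j) F j y).
  by apply/funext => y; rewrite big_cons; case: ifP => // _; rewrite mul1r.
rewrite !E; apply: lipschitz_pairM IH; case: (P i); first exact: H.
exact: lipschitz_pair_cst.
Qed.

Lemma lipschitz_pair_horner (p : {poly K}) f1 f2 : lipschitz_pair f1 f2 ->
  lipschitz_pair (fun y => p.[f1 y]) (fun y => p.[f2 y]).
Proof.
move=> H; elim/poly_ind: p => [|p c IH].
  have E f : (fun y => (0 : {poly K}).[f y]) = cst 0.
    by apply/funext => y; rewrite horner0.
  by rewrite !E; exact: lipschitz_pair_cst.
have E f : (fun y => (p * 'X + c%:P).[f y]) = (fun y => p.[f y] * f y + cst c y).
  by apply/funext => y; rewrite hornerMXaddC.
rewrite !E; apply: lipschitz_pairD; last exact: lipschitz_pair_cst.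
exact: lipschitz_pairM.
Qed.

End LipschitzPairs.

(** * Abelian integrals and the Dubrovin equations *)

(** The summand splits in two: the part free of [c] sums to the logarithmic derivative of the
    product of the [l - x k], and the part with [c] is summed by [lagrange_resolvent], whence the
    minus sign. *)
Lemma sum_form_psi (F : fieldType) (g : nat) (x b d : 'I_g -> F) (l c : F) :
  (0 < g)%N -> (forall k, node_prod x k != 0) -> (forall k, b k != 0) ->
  (forall k, x k != l) -> (forall k, node_prod x k * d k = 2%:R * b k) ->
  \sum_k (b k + c) / (x k - l) / b k * d k =
  (\sum_k - d k * \prod_(j | j != k) (l - x j) - 2%:R * c) / \prod_k (l - x k).
Proof.
move=> g0 q0 b0 xl dE.
have xl0 k : x k - l != 0 by rewrite subr_eq0.
have term k : (b k + c) / (x k - l) / b k * d k =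
    d k / (x k - l) + 2%:R * c * ((x k - l) * node_prod x k)^-1.
  have -> : d k = 2%:R * b k / node_prod x k by rewrite -dE mulrC mulKf.
  by move: (q0 k) (b0 k) (xl0 k) => h1 h2 h3; field; rewrite h1 h2 h3.
rewrite (eq_bigr _ (fun k _ => term k)) big_split /= -mulr_sumr lagrange_resolvent//.
rewrite mulrN mulrBl; congr (_ - _); rewrite mulr_suml; apply: eq_bigr => k _.
have lx0 j : l - x j != 0 by rewrite subr_eq0 eq_sym.
have p0 : \prod_(j | j != k) (l - x j) != 0 by apply/prodf_neq0 => j _.
rewrite [\prod_j (l - x j)](bigD1 k)//=.
move: (\prod_(_ | _) _) p0 (lx0 k) (xl0 k) => p p0 h1 h2.
by field; rewrite h1 h2 p0.
Qed.

(** Here [v] is the value of Psi and [h / w] its logarithmic derivative, so the left side is the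
    second derivative of Psi as the product rule writes it; [e] is [u + lambda] and [t] is [mu] up
    to sign. *)
Lemma riccati_identity (F : numFieldType) (w w1 w2 t e v : F) : w != 0 ->
  - 2%:R^-1 * w * w2 + 4%:R^-1 * w1 ^+ 2 + e * w ^+ 2 = t ^+ 2 ->
  let h := 2%:R^-1 * w1 + t in
  v * (h * (- w1 / w ^+ 2) + w^-1 * (2%:R^-1 * w2)) + h * w^-1 * (v * (h * w^-1))
  = v * e.
Proof.
move=> w0 fi /=.
have -> : e = (t ^+ 2 + 2%:R^-1 * w * w2 - 4%:R^-1 * w1 ^+ 2) / w ^+ 2.
  by rewrite -fi; field.
by field.
Qed.

Section Curve.
Variables (R : realType) (g : nat) (E : 'I_(2 * g + 1) -> Cx R).
Local Notation C := (Cx R).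

Lemma curve_poly_horner (z : C) :
  curve_poly E z = (\prod_j ('X - (E j)%:P)).[z].
Proof.
by rewrite /curve_poly horner_prod; apply: eq_bigr => j _; rewrite hornerXsubC.
Qed.

(** Away from branch points the integral is locally an antiderivative composed with [ga], and the
    chain rule applies. *)
Lemma indef_integral_is_derive (D : set C) (f : C -> C -> C) (ga rho I : C -> C)
    (x d : C) : indef_integral E D f ga rho I -> D x -> rho x != 0 ->
  is_derive x (1 : C) ga d -> is_derive x (1 : C) I (f (ga x) (rho x) * d).
Proof.
move=> [_ _ H] Dx rx gd; have [w [Phi [HP HI]]] := H x Dx rx.
have [_ _ Pd] := nbhs_singleton HP; have [wr _] := nbhs_singleton HI.
apply: (@near_eq_is_derive _ _ _ (Phi \o ga)).
  by apply: filterS HI => y [_ ->].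
by rewrite -wr; apply: is_derive_chain.
Qed.

Lemma curve_sqrt_is_derive (ga rho : C -> C) (x dg dr : C) :
  (\forall y \near x, rho y ^+ 2 = curve_poly E (ga y)) ->
  is_derive x (1 : C) ga dg -> is_derive x (1 : C) rho dr ->
  2%:R * rho x * dr = (\prod_j ('X - (E j)%:P))^`().[ga x] * dg.
Proof.
move=> H gd rd.
have h1 := is_derive_mul rd rd.
have h2 := is_derive_chain (is_derive_horner (\prod_j ('X - (E j)%:P)) (ga x)) gd.
rewrite -(derive1_is_derive h2).
rewrite -[LHS](_ : rho x * dr + rho x * dr = _); last by ring.
rewrite -(derive1_is_derive h1); apply: derive1_is_derive.
apply: near_eq_is_derive; last first.
  exact: (derivable_is_derive1 (@ex_derive _ _ _ _ _ _ _ h2)).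
by apply: filterS H => y; rewrite /= -curve_poly_horner -expr2 => ->.
Qed.

(* Differentiating the Abel system gives a Vandermonde system for the
   quotients [de_k' / si_k]. *)
Lemma abel_system_dubrovin (D : set C) (de si : 'I_g -> C -> C)
    (J : 'I_g -> 'I_g -> C -> C) (a : 'I_g -> C) (dd : 'I_g -> C) (x : C) :
  open D -> abel_system E D de si J a -> D x ->
  (forall k, is_derive x (1 : C) (de k) (dd k)) -> (forall k, si k x != 0) ->
  forall k, node_prod (fun j => de j x) k * dd k = 2%:R * si k x.
Proof.
move=> openD [HJ Hs] Dx hd s0 k.
have := @moments_node_prod _ g (fun j => de j x) (fun j => dd j / si j x) 2%:R.
move=> /(_ _ k) H.
rewrite -[2%:R]H ?mulrA ?divfK//.
move=> n; pose c : C := if n.+1 == g then 2%:R else 0.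
have hJ j : is_derive x (1 : C) (J n j) (de j x ^+ n / si j x * dd j).
  exact: indef_integral_is_derive (HJ n j) Dx (s0 j) (hd j).
have h1 := is_derive_bigsum (index_enum _) hJ.
have h2 : is_derive x (1 : C) (fun y => \sum_j J n j y) c.
  apply: near_eq_is_derive (is_derive_lin c (a n) x).
  apply: (open_near openD) => // y Dy; rewrite Hs// /c.
  by case: ifP => _ //; rewrite mul0r.
rewrite -/c -(derive1_is_derive h2) (derive1_is_derive h1).
by apply: eq_bigr => j _; rewrite mulrAC mulrA.
Qed.

(* By the Dubrovin equations and [curve_sqrt_is_derive], both pairs solve
   [ga_k' = 2 rho_k / node_prod k], [rho_k' = P'(ga_k) / node_prod k], whose
   right-hand side is locally Lipschitz. *)
Lemma dubrovin_unique (ga rho de si : 'I_g -> C -> C)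
    (dga drho dde dsi : 'I_g -> C -> C) (x0 : C) :
  (\forall y \near x0, forall k,
     [/\ is_derive (y : C) (1 : C) (ga k) (dga k y),
         is_derive (y : C) (1 : C) (rho k) (drho k y),
         is_derive (y : C) (1 : C) (de k) (dde k y)
       & is_derive (y : C) (1 : C) (si k) (dsi k y)]) ->
  (\forall y \near x0, forall k,
     [/\ rho k y != 0, si k y != 0,
         node_prod (ga^~ y) k * dga k y = 2%:R * rho k y
       & node_prod (de^~ y) k * dde k y = 2%:R * si k y]) ->
  (forall k, \forall y \near x0,
     rho k y ^+ 2 = curve_poly E (ga k y) /\ si k y ^+ 2 = curve_poly E (de k y)) ->
  (forall k, de k x0 = ga k x0 /\ si k x0 = rho k x0) ->
  \forall y \near x0, forall k, de k y = ga k y.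
Proof.
move=> Hd Hq Hc H0.
pose P := \prod_j ('X - (E j)%:P).
(* Positions and branches form one system of [2 * g] unknowns, indexed by a sum type, to which
   [gronwall_zero] applies at once. *)
pose z (i : 'I_g + 'I_g) (y : C) : C :=
  match i with inl k => de k y - ga k y | inr k => si k y - rho k y end.
pose m y : C := \sum_i `|z i y|.
have m0 y : 0 <= m y by apply: sumr_ge0.
have zm i y : `|z i y| <= m y by rewrite /m (bigD1 i)//= lerDl sumr_ge0.
have Hd0 := nbhs_singleton Hd; have Hq0 := nbhs_singleton Hq.
have cga k : {for x0, continuous (ga k)}.
  by have [h _ _ _] := Hd0 k; exact: is_derive_continuous h.
have crho k : {for x0, continuous (rho k)}.
  by have [_ h _ _] := Hd0 k; exact: is_derive_continuous h.
have cde k : {for x0, continuous (de k)}.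
  by have [_ _ h _] := Hd0 k; exact: is_derive_continuous h.
have csi k : {for x0, continuous (si k)}.
  by have [_ _ _ h] := Hd0 k; exact: is_derive_continuous h.
have lga k : lipschitz_pair x0 m (de k) (ga k).
  by apply: lipschitz_pair_base => // y; exact: (zm (inl k)).
have lrho k : lipschitz_pair x0 m (si k) (rho k).
  by apply: lipschitz_pair_base => // y; exact: (zm (inr k)).
(* This is [node_prod], written with sums and products only so that the closure lemmas for
   [lipschitz_pair] match it. *)
pose Q (a : 'I_g -> C -> C) (k : 'I_g) (y : C) : C :=
  \prod_(j | j != k) (a k y + cst (-1) y * a j y).
have QE a k y : Q a k y = node_prod (a^~ y) k.
  by apply: eq_bigr => j _; rewrite mulN1r.
have cQ (a : 'I_g -> C -> C) k : (forall j, {for x0, continuous (a j)}) ->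
    {for x0, continuous (Q a k)}.
  move=> ca; apply: continuous_bigprod1 => j; apply: continuousD1 => //.
  by apply: continuousM1 => //; exact: continuous_cst1.
have nz (a b : C) (c : C) : b != 0 -> a * c = 2%:R * b -> a != 0.
  move=> b0 h; apply: contra_neq b0 => a0; move/eqP: h.
  by rewrite a0 mul0r eq_sym mulf_eq0 pnatr_eq0 /= => /eqP.
have Qga0 k : Q ga k x0 != 0.
  by have [r0 _ h _] := Hq0 k; rewrite QE; exact: nz r0 h.
have Qde0 k : Q de k x0 != 0.
  by have [_ r0 _ h] := Hq0 k; rewrite QE; exact: nz r0 h.
have lQ k : lipschitz_pair x0 m (fun y => (Q de k y)^-1) (fun y => (Q ga k y)^-1).
  apply: lipschitz_pairV => //; [|exact: cQ|exact: cQ].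
  have h j : lipschitz_pair x0 m (fun y => de k y + cst (-1) y * de j y)
      (fun y => ga k y + cst (-1) y * ga j y).
    apply: (lipschitz_pairD (lga k)).
    exact: (lipschitz_pairM (lipschitz_pair_cst x0 m0 (-1)) (lga j)).
  exact: (lipschitz_pair_prod m0 _ _ h).
(* The right-hand side of the differential system, as a function of a pair of positions [a] and
   branches [b]. *)
pose F1 (i : 'I_g + 'I_g) (a b : 'I_g -> C -> C) (y : C) : C :=
  match i with
  | inl k => cst 2%:R y * b k y * (Q a k y)^-1
  | inr k => P^`().[a k y] * (Q a k y)^-1
  end.
have lF i : lipschitz_pair x0 m (F1 i de si) (F1 i ga rho).
  case: i => k.
    have h := lipschitz_pairM (lipschitz_pair_cst x0 m0 2%:R) (lrho k).
    exact: (lipschitz_pairM h (lQ k)).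
  exact: (lipschitz_pairM (lipschitz_pair_horner m0 _ (lga k)) (lQ k)).
pose Li i := s2val (cid2 (lF i)).
have Li0 i : 0 <= Li i by rewrite /Li; case: cid2.
have LiP : \forall y \near x0, forall i, `|F1 i de si y - F1 i ga rho y| <= Li i * m y.
  apply: (@filter_forall _ _ (fun i y => `|F1 i de si y - F1 i ga rho y| <= Li i * m y)
    _ (nbhs_filter x0)) => i.
  by rewrite /Li; case: cid2 => L L0 /=; apply: filterS => y [].
have zeq : \forall y \near x0, forall i, z i y = 0.
  apply: (@gronwall_zero _ _ z x0 (\sum_i Li i)); first by apply: sumr_ge0.
    by case=> k; have [h1 h2] := H0 k; rewrite /z ?h1 ?h2 subrr.
  (* The curve equation is differentiated at the nearby points [y], so it has to hold on a
     neighbourhood of each of them. *)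
  have Hc' : \forall y \near x0, forall k, \forall w \near y,
     rho k w ^+ 2 = curve_poly E (ga k w) /\ si k w ^+ 2 = curve_poly E (de k w).
    apply: (@filter_forall _ _ (fun k y => \forall w \near y,
     rho k w ^+ 2 = curve_poly E (ga k w) /\ si k w ^+ 2 = curve_poly E (de k w))
      _ (nbhs_filter x0)) => k.
    exact: nbhs_interior (Hc k).
  apply: filterS3 (filterI Hd Hq) Hc' LiP => y [hd hq] hc hL i.
  exists (F1 i de si y - F1 i ga rho y); last first.
    apply: le_trans (hL i) _; rewrite ler_wpM2r// (bigD1 i)//= lerDl.
    exact: sumr_ge0.
  have ode (a b : 'I_g -> C -> C) (da db : C) k :
      b k y != 0 -> node_prod (a^~ y) k * da = 2%:R * b k y ->
      (\forall w \near y, b k w ^+ 2 = curve_poly E (a k w)) ->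
      is_derive y (1 : C) (a k) da -> is_derive y (1 : C) (b k) db ->
      da = F1 (inl k) a b y /\ db = F1 (inr k) a b y.
    move=> b0 h hcu hda hdb; have q0 := nz _ _ _ b0 h; rewrite /F1 QE.
    have daE : da = 2%:R * b k y * (node_prod (a^~ y) k)^-1.
      by rewrite -h mulrC mulKf.
    split=> //; have := curve_sqrt_is_derive hcu hda hdb.
    rewrite daE -/P => h'.
    have b20 : 2%:R * b k y != 0 by rewrite mulf_neq0 ?pnatr_eq0.
    by apply: (mulfI b20); rewrite h' mulrCA.
  have odes k : [/\ dde k y = F1 (inl k) de si y, dsi k y = F1 (inr k) de si y,
      dga k y = F1 (inl k) ga rho y & drho k y = F1 (inr k) ga rho y].
    have [d1 d2 d3 d4] := hd k; have [q1 q2 q3 q4] := hq k.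
    have c1 : \forall w \near y, rho k w ^+ 2 = curve_poly E (ga k w).
      by apply: filterS (hc k) => w [].
    have c2 : \forall w \near y, si k w ^+ 2 = curve_poly E (de k w).
      by apply: filterS (hc k) => w [].
    have [h1 h2] := ode de si _ _ k q2 q4 c2 d3 d4.
    by have [h3 h4] := ode ga rho _ _ k q1 q3 c1 d1 d2.
  case: i => k; have [d1 d2 d3 d4] := hd k; have [h1 h2 h3 h4] := odes k.
    by apply: is_derive_eq (is_deriveB d3 d1) _; rewrite h1 h3.
  by apply: is_derive_eq (is_deriveB d4 d2) _; rewrite h2 h4.
apply: filterS zeq => y hz k; apply/eqP; rewrite -subr_eq0; apply/eqP.
exact: (hz (inl k)).
Qed.

End Curve.

(** * Roots of a finite-gap solution *)

Section FiniteGapRoots.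
Variables (R : realType) (g : nat).
Local Notation C := (Cx R).
Variables (Om : set C) (Om_domain : domain Om) (u : C -> C) (W : C -> {poly C}).
Hypothesis u_finite_gap : finite_gap g Om u W.

Let openOm : open Om := Om_domain.1.

(** The sum stops below [g]: the leading coefficient of [W] is constantly 1 and has zero
    derivatives. For [n = 0] this is therefore [W] without its top term. *)
Definition dW (n : nat) (x : C) : {poly C} :=
  \poly_(i < g) derive1n n (fun y => (W y)`_i) x.

Lemma horner_W (x l : C) : Om x ->
  (W x).[l] = \sum_(i < g) (W x)`_i * l ^+ i + l ^+ g.
Proof.
have [_ _ HW _] := u_finite_gap; move=> /HW[Wm sW].
rewrite horner_coef sW big_ord_recr /=; congr (_ + _).
by move: Wm; rewrite monicE lead_coefE sW => /eqP ->; rewrite mul1r.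
Qed.

Lemma size_dW (n : nat) (x : C) : (size (dW n x) <= g)%N.
Proof. exact: size_poly. Qed.

Lemma horner_dW (n : nat) (x l : C) :
  (dW n x).[l] = \sum_(i < g) derive1n n (fun y => (W y)`_i) x * l ^+ i.
Proof. exact: horner_poly. Qed.

(* Without this, matching [(dW 1 x).[l]] against [(dW 2 x).[l]] unfolds limits. *)
#[local] Opaque dW.

Lemma is_derive_dW (n : nat) (x l : C) : Om x ->
  is_derive x (1 : C) (fun y => (dW n y).[l]) (dW n.+1 x).[l].
Proof.
have [_ HW _ _] := u_finite_gap; move=> Omx.
rewrite [X in is_derive _ _ X _](_ : _ =
    fun y => \sum_(i < g) derive1n n (fun y => (W y)`_i) y * l ^+ i); last first.
  by apply/funext => y; rewrite horner_dW.
rewrite horner_dW; apply: is_derive_bigsum => i.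
have h := is_derive_mul (derivable_is_derive1 (HW i n x Omx))
  (is_derive_cst (l ^+ i) x 1).
by apply: is_derive_eq h _; rewrite mulr0 add0r mulrC.
Qed.

Lemma is_derive_W (x l : C) : Om x ->
  is_derive x (1 : C) (fun y => (W y).[l]) (dW 1 x).[l].
Proof.
move=> Omx.
apply: (@near_eq_is_derive _ _ _ (fun y => (dW 0 y).[l] + cst (l ^+ g) y)).
  apply: (open_near openOm) => // y Omy.
  by rewrite horner_W// horner_dW.
have := is_deriveD (is_derive_dW 0 l Omx) (is_derive_cst (l ^+ g) x 1).
by rewrite addr0.
Qed.

Lemma derive1_W (x l : C) : Om x -> derive1 (fun y => (W y).[l]) x = (dW 1 x).[l].
Proof. by move=> Omx; exact: derive1_is_derive (is_derive_W _ _). Qed.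

Lemma derive2_W (x l : C) : Om x ->
  derive1n 2 (fun y => (W y).[l]) x = (dW 2 x).[l].
Proof.
move=> Omx; apply: derive1_is_derive.
apply: near_eq_is_derive (is_derive_dW 1 l Omx).
by apply: (open_near openOm) => // y Omy; rewrite /= derive1_W.
Qed.

Variable E : 'I_(2 * g + 1) -> C.
Hypothesis E_curve : corresponding_curve E Om u W.

Lemma first_integral (l x : C) : Om x ->
  - 2%:R^-1 * (W x).[l] * (dW 2 x).[l] + 4%:R^-1 * (dW 1 x).[l] ^+ 2
    + (u x + l) * (W x).[l] ^+ 2 = curve_poly E l.
Proof. move=> Omx; rewrite -[RHS](E_curve l Omx) /=.
congr (_ * _ + _ * _ ^+ 2 + _); first exact: esym (derive2_W _ _).
exact: esym (derive1_W _ _). Qed.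

Lemma horner_first_integral (F : fieldType) (A B D : {poly F}) (a b v l : F) :
  (a *: (A * D) + b *: B ^+ 2 + (v%:P + 'X) * A ^+ 2).[l] =
  a * A.[l] * D.[l] + b * B.[l] ^+ 2 + (v + l) * A.[l] ^+ 2.
Proof.
by rewrite !(hornerD, hornerZ, hornerM, hornerC, hornerX, horner_exp) !mulrA.
Qed.

Variable ga : 'I_g -> C -> C.
Hypothesis ga_roots : forall x, Om x -> W x = \prod_k ('X - (ga k x)%:P).

Lemma potential_trace (x : C) : (0 < g)%N -> Om x ->
  u x = 2%:R * \sum_k ga k x - \sum_j E j.
Proof.
move=> g0 Omx.
apply: (@trace_formula _ _ (ga^~ x) E (- 2%:R^-1) 4%:R^-1 _ (W x) (dW 1 x) (dW 2 x)).
- exact: g0.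
- exact: ga_roots.
- exact: size_dW.
- exact: size_dW.
apply: poly_eq_horner => l.
rewrite -curve_poly_horner -(first_integral l Omx).
exact: horner_first_integral.
Qed.

(** The choice of sheet over [ga k]. It is single-valued, and analytic wherever [ga k] is; its sign
    is the one that gives [+ 2] in the Dubrovin equations. *)
Definition branch (k : 'I_g) (x : C) : C := - 2%:R^-1 * (dW 1 x).[ga k x].

(** At a root of [W] only the squared first derivative survives in the first integral. *)
Lemma branch_sqr (k : 'I_g) (x : C) : Om x ->
  branch k x ^+ 2 = curve_poly E (ga k x).
Proof.
move=> Omx; rewrite -(first_integral _ Omx).
have -> : (W x).[ga k x] = 0.
  by rewrite ga_roots// horner_prod (bigD1 k)//= hornerXsubC subrr mul0r.
rewrite /branch exprMn mulr0 mul0r add0r expr0n mulr0 addr0.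
by congr (_ * _); rewrite sqrrN exprVn -natrX.
Qed.

(** * Dubrovin equations, Abel system and quadratures where the roots are analytic *)

Section Subdomain.
Variables (D : set C) (D_domain : domain D) (D_Om : D `<=` Om).
Hypothesis ga_an : forall k, analytic_on D (ga k).

Let openD : open D := D_domain.1.

Lemma branch_analytic (k : 'I_g) : analytic_on D (branch k).
Proof.
have [_ HW _ _] := u_finite_gap.
apply: (analytic_onM openD); first exact: analytic_on_cst.
rewrite (_ : (fun x => _) = fun x =>
  \sum_(i < g) derive1n 1 (fun y => (W y)`_i) x * ga k x ^+ i); last first.
  by apply/funext => x; rewrite horner_dW.
apply: (analytic_on_sum openD) => i; apply: (analytic_onM openD).
  move=> n x /D_Om Omx; rewrite derive1n1 -derive1Sn; exact: HW.
exact: (analytic_onX openD).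
Qed.

Lemma ga_is_derive (k : 'I_g) (x : C) : D x ->
  is_derive x (1 : C) (ga k) (derive1 (ga k) x).
Proof. by move=> Dx; apply: analytic_on_is_derive Dx. Qed.

Lemma dW_roots (x l : C) : D x ->
  (dW 1 x).[l] = \sum_k - derive1 (ga k) x * \prod_(j | j != k) (l - ga j x).
Proof.
move=> Dx; rewrite -(derive1_W _ (D_Om Dx)); apply: derive1_is_derive.
apply: (@near_eq_is_derive _ _ _ (fun y => \prod_k (l - ga k y))).
  apply: (open_near openD) => // y /D_Om Omy; rewrite ga_roots// horner_prod.
  by apply: eq_bigr => k _; rewrite hornerXsubC.
apply: (@is_derive_bigprod _ _ _ (fun k y => l - ga k y)).
  exact: index_enum_uniq.
move=> k; have := is_deriveB (is_derive_cst l x 1) (ga_is_derive k Dx).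
by rewrite sub0r.
Qed.

(** At [l = ga k x] every summand of [dW_roots] except the [k]-th contains a zero factor. *)
Lemma branch_dubrovin (k : 'I_g) (x : C) : D x ->
  node_prod (ga^~ x) k * derive1 (ga k) x = 2%:R * branch k x.
Proof.
move=> Dx; rewrite /branch dW_roots// (bigD1 k)//= [X in _ + X]big1 ?addr0.
  rewrite -/(node_prod (ga^~ x) k).
  by move: (derive1 (ga k) x) (node_prod _ _) => d q; field.
by move=> i ik; rewrite (bigD1 k) 1?eq_sym//= subrr mul0r mulr0.
Qed.

(** A collision of roots kills the left side of a Dubrovin equation, and with it the branch; so the
    roots are distinct where no branch vanishes. *)
Lemma branch_neq0 (x : C) : D x -> (forall k, branch k x != 0) ->
  forall k, node_prod (ga^~ x) k != 0.
Proof.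
move=> Dx b0 k; apply: contra_neq (b0 k) => n0.
have /eqP := branch_dubrovin k Dx; rewrite n0 mul0r eq_sym mulf_eq0 pnatr_eq0 /=.
by move/eqP.
Qed.

Lemma branch_near_neq0 (f : C -> C -> C) (I : 'I_g -> C -> C) (x : C) :
  (forall k, indef_integral E D f (ga k) (branch k) (I k)) -> D x ->
  \forall y \near x^', D y /\ forall k, branch k y != 0.
Proof.
move=> HI Dx; apply: filterI; first exact/nbhs_dnbhs/(open_near openD).
apply: (@filter_forall _ _ (fun k y => branch k y != 0) (dnbhs x)) => k.
by have [_ H _] := HI k; exact: H.
Qed.

(** Off the branch points the Dubrovin equations turn the differentiated sums into twice those of
    [lagrange_moments]. Each sum minus its linear part thus has zero derivative there, and
    [constant_on_domain] crosses the isolated exceptional points. *)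
Lemma abel_forward (J : 'I_g -> 'I_g -> C -> C) :
  (forall n k : 'I_g, indef_integral E D (form_abel n) (ga k) (branch k) (J n k)) ->
  exists a : 'I_g -> C, abel_system E D ga branch J a.
Proof.
move=> HJ.
pose c (n : 'I_g) : C := if n.+1 == g then 2%:R else 0.
pose F n x : C := \sum_k J n k x + (- c n * x + 0).
have Fconst n x y : D x -> D y -> F n x = F n y.
  apply: (constant_on_domain D_domain) => {}x Dx.
    apply: continuousD1.
      by apply: continuous_bigsum1 => k; have [Hc _ _] := HJ n k; exact: Hc.
    exact: is_derive_continuous (is_derive_lin (- c n) 0 x).
  apply: filterS (branch_near_neq0 (HJ n) Dx) => z [Dz bz].
  have hJ k : is_derive z (1 : C) (J n k) (2%:R * (ga k z ^+ n / node_prod (ga^~ z) k)).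
    have nz := branch_neq0 Dz bz k.
    have := indef_integral_is_derive (HJ n k) Dz (bz k) (ga_is_derive k Dz).
    move=> h; apply: is_derive_eq h _; rewrite /form_abel.
    have -> : derive1 (ga k) z = 2%:R * branch k z / node_prod (ga^~ z) k.
      by rewrite -(branch_dubrovin k Dz) mulrC mulKf.
    by have := bz k => b0; field; rewrite nz b0.
  have := is_deriveD (is_derive_bigsum (index_enum _) hJ) (is_derive_lin (- c n) 0 z).
  move=> h; apply: is_derive_eq h _.
  rewrite -mulr_sumr lagrange_moments; last exact: branch_neq0.
  by rewrite /c; case: ifP => _; rewrite ?mulr1 ?mulr0 subrr.
(* A domain may be empty, in which case any constants do; otherwise they are read off at a base
   point [x1]. *)
have [[x1 Dx1]|noD] := pselect (exists x, D x); last first.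
  exists (fun _ => 0); split=> // n x Dx; case: noD; by exists x.
exists (fun n => F n x1); split=> // n x Dx.
rewrite -(Fconst n x x1 Dx Dx1) /F /c addr0; case: ifP => _.
  by rewrite mulNr addrCA subrr addr0.
by rewrite oppr0 mul0r addr0 add0r.
Qed.

(** By continuity no branch vanishes near [x0], so both families satisfy the Dubrovin equations
    there, with the same initial values, and [dubrovin_unique] applies. *)
Lemma abel_inversion (de si : 'I_g -> C -> C) (J : 'I_g -> 'I_g -> C -> C)
    (a : 'I_g -> C) (x0 : C) :
  (forall k, analytic_on D (de k) /\ analytic_on D (si k)) ->
  (forall k x, D x -> si k x ^+ 2 = curve_poly E (de k x)) ->
  abel_system E D de si J a -> D x0 ->
  (forall k, [/\ branch k x0 != 0, de k x0 = ga k x0 & si k x0 = branch k x0]) ->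
  \forall x \near x0, forall k, de k x = ga k x.
Proof.
move=> an sq ab Dx0 H0.
have near_neq0 (f : 'I_g -> C -> C) : (forall k, analytic_on D (f k)) ->
    (forall k, f k x0 != 0) -> \forall y \near x0, forall k, f k y != 0.
  move=> fa f0.
  apply: (@filter_forall _ _ (fun k y => f k y != 0) _ (nbhs_filter x0)) => k.
  apply: continuous_neq0 (f0 k).
  exact: is_derive_continuous (analytic_on_is_derive (fa k) Dx0).
have nD : \forall y \near x0, D y by exact: (open_near openD).
have nb : \forall y \near x0, forall k, branch k y != 0.
  by apply: near_neq0 => k; [exact: branch_analytic | have [] := H0 k].
have ns : \forall y \near x0, forall k, si k y != 0.
  apply: near_neq0 => k; first by have [] := an k.
  by have [? _ ->] := H0 k.
apply: (@dubrovin_unique _ _ E ga branch de si (fun k => derive1 (ga k))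
  (fun k => derive1 (branch k)) (fun k => derive1 (de k)) (fun k => derive1 (si k))).
- apply: filterS nD => y Dy k; have [a1 a2] := an k; split.
  + exact: ga_is_derive.
  + exact: analytic_on_is_derive (@branch_analytic k) Dy.
  + exact: analytic_on_is_derive a1 Dy.
  + exact: analytic_on_is_derive a2 Dy.
- apply: filterS3 nD nb ns => y Dy b0 s0 k; split=> //.
    exact: branch_dubrovin.
  have ded j := analytic_on_is_derive (proj1 (an j)) Dy.
  exact: (abel_system_dubrovin openD ab Dy ded s0).

- move=> k; apply: filterS nD => y Dy; split; last exact: sq.
  exact: branch_sqr (D_Om Dy).
- by move=> k; have [] := H0 k.
Qed.

(** As [l] is never a root, [W] has no zero at [l] and the logarithmic derivative [H] is regular on
    all of [D], branch points included; the second derivative of Psi then follows from the Riccati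
    equation. *)
Lemma quadrature (l mu s : C) (I : 'I_g -> C -> C) :
  (0 < g)%N -> mu ^+ 2 = curve_poly E l -> s ^+ 2 = 1 ->
  (forall k x, D x -> ga k x != l) ->
  (forall k, indef_integral E D (form_psi s l mu) (ga k) (branch k) (I k)) ->
  schrodinger_solution D u l (fun x => cexp (2%:R^-1 * \sum_k I k x)).
Proof.
move=> g0 mu2 s2 gal HI.
pose w y : C := (W y).[l]; pose w1 y : C := (dW 1 y).[l].
have wE y : D y -> w y = \prod_k (l - ga k y).
  move=> /D_Om Omy; rewrite /w ga_roots// horner_prod.
  by apply: eq_bigr => k _; rewrite hornerXsubC.
have w0 y : D y -> w y != 0.
  move=> Dy; rewrite wE//; apply/prodf_neq0 => k _.
  by rewrite subr_eq0 eq_sym gal.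
have wd y : D y -> is_derive y (1 : C) w (w1 y).
  by move=> /D_Om Omy; exact: is_derive_W.
have w1d y : D y -> is_derive y (1 : C) w1 (dW 2 y).[l].
  by move=> /D_Om Omy; exact: is_derive_dW.
pose H y : C := (2%:R^-1 * w1 y + (- s * mu)) * (w y)^-1.
pose S y : C := 2%:R^-1 * \sum_k I k y.
have hn y : D y -> is_derive y (1 : C) (fun y => 2%:R^-1 * w1 y + (- s * mu))
    (2%:R^-1 * (dW 2 y).[l]).
  move=> Dy.
  have h := is_deriveD (is_derive_mul (is_derive_cst (2%:R^-1 : C) y 1) (w1d y Dy))
    (is_derive_cst (- s * mu) y 1).
  by apply: is_derive_eq h _; rewrite mulr0 !addr0.
have Hd y (Dy : D y) := is_derive_mul (hn y Dy) (is_derive_inv (w0 y Dy) (wd y Dy)).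
have Sc y : D y -> {for y, continuous S}.
  move=> Dy; apply: continuousM1; first exact: continuous_cst1.
  by apply: continuous_bigsum1 => k; have [Hc _ _] := HI k; exact: Hc.
(* Term by term differentiation gives [H] off the branch points, and [is_derive_extend] carries the
   formula across them. *)
have Sd x : D x -> is_derive x (1 : C) S (H x).
  move=> Dx; apply: is_derive_extend.
  - by apply: (open_near openD).
  - apply: filterS (branch_near_neq0 HI Dx) => y [Dy b0].
    have hI k := indef_integral_is_derive (HI k) Dy (b0 k) (ga_is_derive k Dy).
    have h := is_derive_mul (is_derive_cst (2%:R^-1 : C) y 1)
      (is_derive_bigsum (index_enum _) hI).
    apply: is_derive_eq h _; rewrite mulr0 addr0.
    rewrite /form_psi (@sum_form_psi _ _ (ga^~ y)) //; first last.
    + by move=> k; exact: branch_dubrovin.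
    + by move=> k; exact: gal.
    + exact: branch_neq0.
    rewrite -dW_roots// -wE// /H mulrA; congr (_ / _).
    rewrite mulrBr mulKf ?pnatr_eq0// mulNr; congr (_ - _).
  - exact: is_derive_continuous (Hd x Dx).
have Pd x : D x -> is_derive x (1 : C) (fun y => cexp (S y)) (cexp (S x) * H x).
  by move=> Dx; exact: is_derive_chain (is_derive_cexp (S x)) (Sd x Dx).
move=> x Dx.
have P2 := is_derive_mul (Pd x Dx) (Hd x Dx).
have P2' : is_derive x (1 : C) (derive1 (fun y => cexp (S y)))
   (cexp (S x) * (u x + l)).
  apply: near_eq_is_derive; last first.
    apply: is_derive_eq P2 _; apply: riccati_identity; first exact: w0.
    have -> : (- s * mu) ^+ 2 = curve_poly E l by rewrite exprMn sqrrN s2 mul1r mu2.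
    exact: first_integral (D_Om Dx).
  by apply: (open_near openD) => // y Dy; rewrite (derive1_is_derive (Pd y Dy)).
split.
- by have [] := Pd x Dx.
- by have [] := P2'.
- rewrite -[derive1n 2 _]/(derive1 (derive1 _)) (derive1_is_derive P2').
  by rewrite mulrDr [u x * _]mulrC addrAC subrr add0r mulrC.
Qed.

End Subdomain.
End FiniteGapRoots.

Theorem theorem4p2 (R : realType) (g : nat) (g_gt0 : (0 < g)%N)
  (Om : set (Cx R)) (Om_domain : domain Om)
  (u : Cx R -> Cx R) (W : Cx R -> {poly Cx R})
  (u_finite_gap : finite_gap g Om u W)
  (E : 'I_(2 * g + 1) -> Cx R)
  (E_curve : corresponding_curve E Om u W)
  (ga : 'I_g -> Cx R -> Cx R)
  (ga_roots : forall x, Om x -> W x = \prod_k ('X - (ga k x)%:P)) :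
  (forall x, Om x -> u x = 2%:R * \sum_k ga k x - \sum_j E j) /\
  exists rho : 'I_g -> Cx R -> Cx R,
    (forall k x, Om x -> rho k x ^+ 2 = curve_poly E (ga k x)) /\
    forall D : set (Cx R), domain D -> D `<=` Om ->
      (forall k, analytic_on D (ga k)) ->
      [/\ (forall k, analytic_on D (rho k)),
          (* the roots satisfy the system of indefinite integrals *)
          (forall J : 'I_g -> 'I_g -> Cx R -> Cx R,
             (forall n k : 'I_g,
                indef_integral E D (form_abel n) (ga k) (rho k) (J n k)) ->
             exists a : 'I_g -> Cx R, abel_system E D ga rho J a),
          (* inversion: the system determines the roots locally *)
          (forall (de si : 'I_g -> Cx R -> Cx R)
                  (J : 'I_g -> 'I_g -> Cx R -> Cx R) (a : 'I_g -> Cx R)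
                  (x0 : Cx R),
             (forall k, analytic_on D (de k) /\ analytic_on D (si k)) ->
             (forall k x, D x -> si k x ^+ 2 = curve_poly E (de k x)) ->
             abel_system E D de si J a ->
             D x0 ->
             (forall k, [/\ rho k x0 != 0, de k x0 = ga k x0
                          & si k x0 = rho k x0]) ->
             \forall x \near x0, forall k, de k x = ga k x)
        & (* the quadratures for Psi^+ (s = 1) and Psi^- (s = -1) *)
          (forall (l mu s : Cx R) (I : 'I_g -> Cx R -> Cx R),
             mu ^+ 2 = curve_poly E l ->
             s = 1 \/ s = -1 ->
             (forall k x, D x -> ga k x != l) ->
             (forall k,
                indef_integral E D (form_psi s l mu) (ga k) (rho k) (I k)) ->
             schrodinger_solution D u l
               (fun x => cexp (2%:R^-1 * \sum_k I k x)))].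
Proof.
split.
  by move=> x Omx; apply: (potential_trace Om_domain u_finite_gap E_curve ga_roots).
(* The branch is fixed before [D], so one choice of square root serves the Abel system and both
   quadratures. *)
exists (branch W ga); split=> [k x Omx|D D_domain D_Om ga_an].
  exact: (branch_sqr Om_domain u_finite_gap E_curve ga_roots).
split.
- by move=> k; exact: (branch_analytic u_finite_gap D_domain D_Om ga_an).
- exact: (abel_forward Om_domain u_finite_gap ga_roots D_domain D_Om ga_an).
- exact: (abel_inversion Om_domain u_finite_gap E_curve ga_roots D_domain D_Om ga_an).
- move=> l mu s I mu2 s1.
  apply: (quadrature Om_domain u_finite_gap E_curve ga_roots D_domain D_Om ga_an) => //.
  by case: s1 => ->; rewrite ?sqrrN expr1n.
Qed.
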